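(* Let $(X,d,\mu)$ and $(Y,\rho,\nu)$ be metric measure spaces, where $(X,d)$ is complete and separable, $\mu$ is a Borel regular measure on $X$ that is finite on bounded sets, and $\nu$ is a Borel measure on $Y$. Let $V$ be a $\mu$ Vitali relation on $X$, let $E\subset X$ be closed and let $f:E\to Y$ be continuous. Assume that the pull-back measure $f^*\nu$ is finite on bounded sets and absolutely continuous with respect to $\mu$. Then the metric Jacobian $$Jf(x)=(V)\limsup_{S\to x}\frac{f^*\nu(S)}{\mu(S)}\qquad (x\in E)$$ is $\mu$-a.e. finite, and for every $\mu$-measurable set $A\subset E$ we have $$\int_A Jf(x)\,d\mu(x)=\int_Y N(f,A,y)\,d\nu(y).$$
   Context: Measures. ''Measure'' on a set means a countably subadditive, nonnegative ($[0,\infty]$-valued) set function defined on all subsets and vanishing on $\emptyset$ (an outer measure); measurability is in the sense of Carathéodory. A Borel measure is one for which all Borel sets are measurable; it is Borel regular if moreover every set is contained in a Borel set of the same measure. A measure $\zeta$ on $X$ is absolutely continuous with respect to $\mu$ if $\mu(A)=0$ implies $\zeta(A)=0$, for $A\subset X$. Vitali relation. A covering relation on $X$ is a subset $C$ of $\{(x,S): x\in S\subset X\}$. For $Z\subset X$ put $C(Z)=\{S: (x,S)\in C \text{ for some } x\in Z\}$. $C$ is fine at $x$ if $\inf\{\mathrm{diam}(S): (x,S)\in C\}=0$. A $\mu$ Vitali relation is a covering relation $V$ such that $V(X)$ is a family of Borel subsets of $X$, $V$ is fine at each point of $X$, and the following holds: whenever $C\subset V$, $Z\subset X$ and $C$ is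 fine at each point of $Z$, the family $C(Z)$ has a countable disjoint subfamily covering $\mu$-almost all of $Z$. Limits along $V$. For an extended-real-valued function $\varphi$ of sets $S$ with domain $\mathrm{dmn}(\varphi)$, $$(V)\limsup_{S\to x}\varphi(S)=\lim_{\varepsilon\to0^+}\sup\{\varphi(S): (x,S)\in V,\ S\in \mathrm{dmn}(\varphi),\ \mathrm{diam}(S)<\varepsilon\}.$$ For a quotient with denominator $\mu(S)$, the indeterminate expression $0/0$ is regarded as undefined, i.e. such $S$ are not in the domain. Pull-back measure. For $S\subset E$ put $\zeta(S)=\nu(f(S))$. For $A\subset E$ and $\delta>0$ let $$\phi_\delta(A)=\inf\Big\{\sum_{B\in G}\zeta(B): G \text{ a countable family of Borel subsets of } E \text{ of diameter}\le\delta,\ A\subset\bigcup_{B\in G} B\Big\},$$ and $f^*\nu(A)=\sup_{\delta>0}\phi_\delta(A)$ (Carathéodory's construction applied with $\zeta$ on the family of Borel sets). It is extended to all $A\subset X$ by $f^*\nu(A)=f^*\nu(A\cap E)$. Multiplicity function. For $A\subset E$ and $y\in Y$, $N(f,A,y)=\#\big(A\cap f^{-1}(y)\big)\in\{0,1,2,\dots\}\cup\{\infty\}$. *)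

(* Defs.v *)
From HB Require Import structures.
From mathcomp Require Import all_boot all_order all_algebra.
From mathcomp Require Import all_classical all_reals all_analysis.
From mathcomp Require Import measurable_realfun.

Set Implicit Arguments.
Unset Strict Implicit.
Unset Printing Implicit Defensive.

Import Order.TTheory GRing.Theory Num.Theory.

Local Open Scope classical_set_scope.
Local Open Scope ring_scope.
Local Open Scope ereal_scope.

(* The library's [measurableType]s and [completeType]s are pointed, whence the
   pointed versions of its metric spaces. *)
#[short(type="pmetricType")]
HB.structure Definition PointedMetric (K : numDomainType) :=
  {M of Pointed M & Metric K M}.

#[short(type="completeMetricType")]
HB.structure Definition CompleteMetric (K : numDomainType) :=
  {M of Complete M & PointedMetric K M}.

Definition separable_space (T : topologicalType) : Prop :=
  exists D : set T, countable D /\ dense D.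

Definition borel (T : topologicalType) : set (set T) := <<s open >>.
Arguments borel : clear implicits.

(* Borel sets of the topological subspace E, as subsets of E. *)
Definition borel_subspace (T : topologicalType) (E : set T) : set (set T) :=
  <<s E, [set U `&` E | U in open] >>.

Section metric.
Context {R : realType} {X : metricType R}.

(* The maximum with 0 only serves to give the empty set diameter 0. *)
Definition diam (S : set X) : \bar R :=
  maxe 0 (ereal_sup [set (mdist p.1 p.2)%:E | p in S `*` S]).

Definition finite_on_bounded (phi : set X -> \bar R) : Prop :=
  forall A, diam A < +oo -> phi A < +oo.

End metric.

(* A "measure" on a set is an outer measure. *)
Section measures.
Context {R : realType} {T : topologicalType}.

Definition borel_measure (mu : {outer_measure set T -> \bar R}) : Prop :=
  borel T `<=` mu.-caratheodory.

Definition borel_regular (mu : {outer_measure set T -> \bar R}) : Prop :=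
  borel_measure mu /\
  forall A, exists B, [/\ borel T B, A `<=` B & mu B = mu A].

End measures.

Definition abs_continuous {R : realType} {T : Type}
    (zeta mu : set T -> \bar R) : Prop :=
  forall A, mu A = 0 -> zeta A = 0.

Section vitali.
Context {R : realType} {X : metricType R}.
Implicit Types (C V : set (X * set X)) (Z : set X) (mu : set X -> \bar R).

Definition covering_relation C : Prop :=
  C `<=` [set p | p.2 p.1].

Definition cov_family C Z : set (set X) :=
  [set S | exists2 x, Z x & C (x, S)].

Definition fine_at C (x : X) : Prop :=
  ereal_inf [set diam S | S in [set S | C (x, S)]] = 0.

Definition vitali_relation mu V : Prop :=
  [/\ covering_relation V,
      cov_family V setT `<=` borel X,
      (forall x, fine_at V x) &
      forall C Z, C `<=` V -> (forall x, Z x -> fine_at C x) ->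
        exists G : set (set X),
          [/\ G `<=` cov_family C Z, countable G, trivIset G id &
              mu (Z `\` \bigcup_(S in G) S) = 0]].

(* Upper limit along V at x of a function phi of sets with domain dmn. *)
Definition vlimsup V (dmn : set (set X)) (phi : set X -> \bar R) (x : X)
    : \bar R :=
  lim (ereal_sup [set phi S | S in
         [set S | [/\ V (x, S), dmn S & diam S < eps%:E]]] @[eps --> (0:R)^'+]).

(* The quotient psi / mu has no value where it reads 0 / 0; in \bar R,
   0^-1 = +oo, so it is +oo where psi > 0 = mu. *)
Definition vlimsup_quotient V (psi mu : set X -> \bar R) (x : X) : \bar R :=
  vlimsup V [set S | ~ (psi S = 0 /\ mu S = 0)] (fun S => psi S / mu S) x.

End vitali.

Section pullback.
Context {R : realType} {X : metricType R}.

(* Caratheodory's construction from zeta on the family F. *)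
Definition caratheodory_delta (F : set (set X)) (zeta : set X -> \bar R)
    (delta : R) (A : set X) : \bar R :=
  ereal_inf [set \esum_(B in G) zeta B | G in
    [set G | [/\ G `<=` F, countable G,
                 (forall B, G B -> diam B <= delta%:E) &
                 A `<=` \bigcup_(B in G) B]]].

Definition caratheodory_construction (F : set (set X))
    (zeta : set X -> \bar R) (A : set X) : \bar R :=
  ereal_sup [set caratheodory_delta F zeta delta A | delta in
    [set delta : R | (0 < delta)%R]].

(* f stands for a map E -> Y: its values outside E play no role. *)
Definition pullback {Y : Type} (E : set X) (f : X -> Y)
    (nu : set Y -> \bar R) (A : set X) : \bar R :=
  caratheodory_construction (borel_subspace E) (fun S => nu (f @` S)) (A `&` E).

Definition metric_jacobian {Y : Type} (V : set (X * set X)) (E : set X)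
    (f : X -> Y) (mu : set X -> \bar R) (nu : set Y -> \bar R) : X -> \bar R :=
  vlimsup_quotient V (pullback E f nu) mu.

End pullback.

Definition multiplicity {R : realType} {X : choiceType} {Y : Type}
    (f : X -> Y) (A : set X) (y : Y) : \bar R :=
  counting (A `&` f @^-1` [set y]).

(* Main.v *)
Require Import Defs.
From HB Require Import structures.
From mathcomp Require Import all_boot all_order all_algebra finmap.
From mathcomp Require Import all_classical all_reals all_analysis.
From mathcomp Require Import measurable_realfun.
From mathcomp Require Import lra.

Set Implicit Arguments.
Unset Strict Implicit.
Unset Printing Implicit Defensive.

Import Order.TTheory GRing.Theory Num.Theory.

Local Open Scope classical_set_scope.
Local Open Scope ring_scope.
Local Open Scope ereal_scope.

(** Write [psi] for the pull-back measure and [D] for the metric Jacobian, the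
    upper derivative of [psi] with respect to [mu] along [V].  Two formulas
    are combined: [psi A = \int[nu]_y N(f, A, y)] and
    [psi A = \int[mu]_(x in A) D x], both for every [mu]-measurable subset
    [A] of [E].

    The pull-back is an outer measure.  As Caratheodory's construction only
    uses covers by sets of small diameter, it is additive on sets at positive
    distance, and Caratheodory's criterion makes Borel sets measurable
    ([pullback_borel]).

    Image sets are measurable without any appeal to analytic sets
    ([image_caratheodory]).  A [mu]-measurable set is a Borel set up to a
    [mu]-null, hence [psi]-null, set; by Ulam's theorem ([compact_exhaustion])
    a bounded Borel set is a countable union of compact sets up to a
    [psi]-null set.  Compact sets have compact images, and
    [nu (f @` S) <= psi S] makes the images of [psi]-null sets null.

    For the first formula ([pullback_integral]), cut [A] along a countable
    Borel partition into pieces of diameter at most [1 / (k + 1)], and let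
    [g_k y] be the number of pieces whose image contains [y].  Then
    [g_k <= N(f, A, .)] and [g_k] converges pointwise to [N(f, A, .)], because
    finitely many points of a fibre are eventually separated by the pieces.
    The integral of [g_k] is the sum of the measures of the images of the
    pieces; this sum is at most [psi A] by additivity, and at least the
    approximating outer measure of the construction.  Fatou's lemma in one
    direction and [g_k <= N(f, A, .)] in the other give the equality.

    The second formula is the differentiation theorem ([vitali_density]).
    By the Radon-Nikodym theorem [psi] has a density [h] with respect to [mu],
    with values in [[0, +oo[].  The Vitali property shows that
    [c * mu Z <= psi Z'] when [D > c] on [Z] and [Z'] is a measurable set
    containing [Z] ([upper_derivative_gt]), and that [psi Z' <= a * mu Z']
    when [D < a] on [Z] and [Z'] is a measurable hull of [Z]
    ([upper_derivative_lt]).  Compared with the bounds that [h] gives for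
    [psi Z'], these show that [D = h] almost everywhere.  This is proved for
    arbitrary, not necessarily measurable, sets [Z], so that the measurability
    of [D] is a consequence. *)

(** * Caratheodory's construction *)

Lemma le_esum_set {R : realType} {T : choiceType} (I J : set T)
    (a : T -> \bar R) :
  I `<=` J -> \esum_(i in I) a i <= \esum_(i in J) a i.
Proof.
move=> IJ; apply: le_ereal_sup => _ [F [finF FI] <-].
by exists F => //; split => //; exact: subset_trans IJ.
Qed.

Lemma le_esum_bigcup {R : realType} {T : choiceType} (J : (set T)^nat)
    (a : T -> \bar R) : (forall x, 0 <= a x) ->
  \esum_(i in \bigcup_k J k) a i <= \sum_(k <oo) \esum_(i in J k) a i.
Proof.
move=> a0; rewrite seqDU_bigcup_eq esum_bigcupT//.
rewrite -nneseries_esumT; last by move=> n; exact: esum_ge0.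
apply: lee_nneseries => [k _ _|k _]; first exact: esum_ge0.
by apply: le_esum_set; exact: subset_seqDU.
Qed.

Section diameter.
Context {R : realType} {X : metricType R}.
Implicit Types (A B S : set X).

Lemma diam_ge0 S : 0 <= diam S.
Proof. by rewrite /diam le_max lexx. Qed.

Lemma mdist_le_diam S x y : S x -> S y -> (mdist x y)%:E <= diam S.
Proof.
move=> Sx Sy; rewrite /diam le_max; apply/orP; right.
by apply: ereal_sup_ubound; exists (x, y).
Qed.

Lemma diam_le S (r : R) : (0 <= r)%R ->
  (forall x y, S x -> S y -> (mdist x y <= r)%R) -> diam S <= r%:E.
Proof.
move=> r0 Sr; rewrite /diam ge_max lee_fin r0/=.
by apply: ge_ereal_sup => _ [[x y] [/= Sx Sy] <-]; rewrite lee_fin Sr.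
Qed.

Lemma le_diam A B : A `<=` B -> diam A <= diam B.
Proof.
move=> AB; rewrite /diam ge_max le_max lexx/= le_max.
apply/orP; right; apply: le_ereal_sup => _ [[x y] [/= Ax Ay] <-].
by exists (x, y) => //; split; exact: AB.
Qed.

Lemma diam_ball_lty (x : X) (r : R) : diam (ball x r) < +oo.
Proof.
rewrite (@le_lt_trans _ _ (Num.max 0%R (r + r)%R)%:E) ?ltry//.
apply: diam_le => [|y z]; first by rewrite le_max lexx.
rewrite !ballEmdist/= => xy xz; rewrite le_max; apply/orP; right.
by rewrite (le_trans (metric_triangle y x z))// metric_sym lerD// ltW.
Qed.

End diameter.

Section construction.
Context {R : realType} {X : metricType R}.
Variables (F : set (set X)) (zeta : set X -> \bar R).
Hypothesis zeta_ge0 : forall S, 0 <= zeta S.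

Let phi := caratheodory_delta F zeta.
Let psi := caratheodory_construction F zeta.

Let phi_ge0 delta A : 0 <= phi delta A.
Proof. by apply: le_ereal_inf_tmp => _ [G _ <-]; exact: esum_ge0. Qed.

Let phi0 delta : phi delta set0 = 0.
Proof.
apply/eqP; rewrite eq_le phi_ge0 andbT; apply: ereal_inf_lbound.
exists set0; last by rewrite esum_set0.
by split => //; exact: countable0.
Qed.

Let le_phi delta A B : A `<=` B -> phi delta A <= phi delta B.
Proof.
move=> AB; apply: le_ereal_inf_tmp => _ [G [GF cG dG BG] <-].
apply: ereal_inf_lbound; exists G => //; split => //.
exact: subset_trans BG.
Qed.

Lemma caratheodory_delta_sigma_subadditive delta :
  sigma_subadditive (caratheodory_delta F zeta delta).
Proof.
move=> A; rewrite -/phi.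
have [[i ioo]|/forallNP Aoo] := pselect (exists i, phi delta (A i) = +oo).
  rewrite (eseries_pinfty _ _ ioo) ?leey// => n _.
  by rewrite -ltNye (lt_le_trans _ (phi_ge0 _ _)).
apply/lee_addgt0Pr => e e0.
rewrite (le_trans _ (epsilon_trick _ _ (ltW e0)))//.
pose P n (G : set (set X)) := [/\ G `<=` F, countable G,
  (forall B, G B -> diam B <= delta%:E), A n `<=` \bigcup_(B in G) B &
  \esum_(B in G) zeta B <= phi delta (A n) + (e / (2 ^ n.+1)%:R)%:E].
have [G PG] : {G : nat -> set (set X) & forall n, P n (G n)}.
  apply: (@choice _ _ P) => n.
  have en0 : (0 < e / (2 ^ n.+1)%:R)%R by rewrite divr_gt0// ltr0n expn_gt0.
  have : phi delta (A n) \is a fin_num.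
    by rewrite ge0_fin_numE// ltey; exact/eqP/Aoo.
  move=> /(lb_ereal_inf_adherent en0)[_ [G [GF cG dG AG] <-]] /ltW GA.
  by exists G.
apply: (@le_trans _ _ (\esum_(B in \bigcup_n G n) zeta B)).
  apply: ereal_inf_lbound; exists (\bigcup_n G n) => //; split.
  - by move=> B [n _]; have [+ _ _ _ _] := PG n; exact.
  - by apply: bigcup_countable => // n _; have [] := PG n.
  - by move=> B [n _]; have [_ _ + _ _] := PG n; exact.
  - move=> x [n _]; have [_ _ _ + _] := PG n => /[apply] -[B GB Bx].
    by exists B => //; exists n.
rewrite (le_trans (le_esum_bigcup _ _))// lee_nneseries => [//|n _ _|n _].
  exact: esum_ge0.
by have [] := PG n.
Qed.

Let le_psi delta A : (0 < delta)%R -> phi delta A <= psi A.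
Proof. by move=> d0; apply: ereal_sup_ubound; exists delta. Qed.

Lemma caratheodory_construction_ge0 A : 0 <= caratheodory_construction F zeta A.
Proof. exact: le_trans (phi_ge0 1 A) (le_psi _ _). Qed.

Lemma caratheodory_construction0 : caratheodory_construction F zeta set0 = 0.
Proof.
apply/eqP; rewrite eq_le caratheodory_construction_ge0 andbT.
by apply: ge_ereal_sup => _ [d _ <-]; rewrite -/phi phi0.
Qed.

Lemma le_caratheodory_construction A B : A `<=` B ->
  caratheodory_construction F zeta A <= caratheodory_construction F zeta B.
Proof.
move=> AB; apply: ge_ereal_sup => _ [d d0 <-].
exact: le_trans (le_phi _ AB) (le_psi _ _).
Qed.

Lemma caratheodory_construction_sigma_subadditive :
  sigma_subadditive (caratheodory_construction F zeta).
Proof.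
move=> A; apply: ge_ereal_sup => _ [d d0 <-].
rewrite (le_trans (caratheodory_delta_sigma_subadditive _ _))//.
by apply: lee_nneseries => n _ //; exact: le_psi.
Qed.

(** A set of diameter less than the distance between [A] and [B] cannot meet
    both, so that a cover of the union by such sets splits. *)
Let phiU delta (r : R) A B : (delta < r)%R ->
  (forall x y, A x -> B y -> (r <= mdist x y)%R) ->
  phi delta A + phi delta B <= phi delta (A `|` B).
Proof.
move=> dr AB; apply: le_ereal_inf_tmp => _ [G [GF cG dG ABG] <-].
rewrite (@esumID _ _ [set S | S `&` A !=set0])//.
apply: leeD; apply: ereal_inf_lbound;
  (eexists; [split; last first|reflexivity]).
- move=> x Ax; have [|S GS Sx] := ABG x; first by left.
  by exists S => //; split => //; exists x.
- by move=> S [/dG].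
- by apply: (sub_countable _ cG); apply: subset_card_le => S [].
- by move=> S [/GF].
- move=> x Bx; have [|S GS Sx] := ABG x; first by right.
  exists S => //; split => // -[y [Sy Ay]].
  have := le_trans (mdist_le_diam Sy Sx) (dG _ GS).
  by rewrite lee_fin leNgt (lt_le_trans dr)// AB.
- by move=> S [/dG].
- by apply: (sub_countable _ cG); apply: subset_card_le => S [].
- by move=> S [/GF].
Qed.

(** The construction is additive on sets at positive distance, since only
    covers by sets of small diameter matter. *)
Lemma caratheodory_construction_metric A B (r : R) : (0 < r)%R ->
  (forall x y, A x -> B y -> (r <= mdist x y)%R) ->
  caratheodory_construction F zeta A + caratheodory_construction F zeta B <=
  caratheodory_construction F zeta (A `|` B).
Proof.
move=> r0 AB; rewrite -/psi.
have phi_anti d d' S : (d <= d')%R -> phi d' S <= phi d S.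
  move=> dd'; apply: le_ereal_inf_tmp => _ [G [GF cG dG SG] <-].
  apply: ereal_inf_lbound; exists G => //; split => // S' /dG /le_trans; apply.
  by rewrite lee_fin.
have key d d' : (0 < d)%R -> (0 < d')%R ->
    phi d A + phi d' B <= psi (A `|` B).
  move=> d0 d'0; pose m := Num.min (Num.min d d') (r / 2)%R.
  have m0 : (0 < m)%R by rewrite !lt_min d0 d'0 divr_gt0.
  rewrite (le_trans _ (le_psi _ m0))// (le_trans _ (@phiU _ r _ _ _ AB))//.
    by rewrite leeD// phi_anti// !ge_min lexx ?orbT.
  by rewrite gt_min ltr_pdivrMr// ltr_pMr// ltr1n orbT.
have [->|] := eqVneq (psi (A `|` B)) +oo; first by rewrite leey.
rewrite -ltey => ABoo.
have fin S : S `<=` A `|` B -> psi S \is a fin_num.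
  move=> SAB; rewrite ge0_fin_numE ?caratheodory_construction_ge0//.
  by rewrite (le_lt_trans (le_caratheodory_construction SAB)).
have phifin d S : (0 < d)%R -> S `<=` A `|` B -> phi d S \is a fin_num.
  move=> d0 SAB; rewrite ge0_fin_numE// (le_lt_trans (le_psi _ d0))//.
  by rewrite -ge0_fin_numE ?fin// caratheodory_construction_ge0.
rewrite -leeBrDr; last by apply: fin; right.
apply: ge_ereal_sup => _ [d d0 <-].
rewrite leeBrDr; last by apply: fin; right.
rewrite addeC -leeBrDr; last by apply: phifin => //; left.
apply: ge_ereal_sup => _ [d' d'0 <-].
by rewrite leeBrDr; [rewrite addeC; exact: key|apply: phifin => //; left].
Qed.

End construction.

(** The pull-back of an outer measure is an outer measure. *)
Section pullback_outer_measure.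
Context {R : realType} {X : metricType R} {Y : Type}.
Variables (E : set X) (f : X -> Y) (nu : {outer_measure set Y -> \bar R}).

Let zeta_ge0 S : 0 <= nu (f @` S).
Proof. exact: outer_measure_ge0. Qed.

Let pullback0 : pullback E f nu set0 = 0.
Proof. by rewrite /pullback set0I; exact: caratheodory_construction0. Qed.

Let pullback_ge0 A : 0 <= pullback E f nu A.
Proof. exact: caratheodory_construction_ge0. Qed.

Let le_pullback : {homo pullback E f nu : A B / A `<=` B >-> A <= B}.
Proof.
by move=> A B AB; apply: le_caratheodory_construction => //; exact: setSI.
Qed.

Let pullback_sigma_subadditive : sigma_subadditive (pullback E f nu).
Proof.
by move=> A; rewrite /pullback setI_bigcupl;
  exact: caratheodory_construction_sigma_subadditive.
Qed.

HB.instance Definition _ := isOuterMeasure.Build R X (pullback E f nu)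
  pullback0 pullback_ge0 le_pullback pullback_sigma_subadditive.

End pullback_outer_measure.

(** * Caratheodory's criterion *)

Lemma exists_invS_lt {R : realType} (e : R) : (0 < e)%R ->
  exists n, (n.+1%:R^-1 < e)%R.
Proof.
move=> e0; exists (Num.truncn e^-1); rewrite invf_plt ?posrE ?ltr0n//.
exact: Num.Theory.truncnS_gt.
Qed.

Section criterion.
Context {R : realType} {X : metricType R}.
Variable mu : {outer_measure set X -> \bar R}.
Hypothesis mu_metric : forall A B (r : R), (0 < r)%R ->
  (forall x y, A x -> B y -> (r <= mdist x y)%R) -> mu A + mu B <= mu (A `|` B).

(** An outer measure that is additive on sets at positive distance makes the
    closed sets measurable. *)
Lemma metric_outer_measure_closed C : closed C -> mu.-caratheodory C.
Proof.
move=> cC; apply: le_caratheodory_measurable => T.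
have [->|] := eqVneq (mu T) +oo; first by rewrite leey.
rewrite -ltey => Too.
have muI A : A `<=` T -> mu A <= mu T by exact: le_outer_measure.
(* The part of T at distance at least 1 / (n + 1) from C. *)
pose D n := [set x | T x /\ forall c, C c -> (n.+1%:R^-1 <= mdist x c)%R].
have DT n : D n `<=` T by move=> x [].
have DS n m : (n <= m)%N -> D n `<=` D m.
  move=> nm x [Tx Dx]; split => // c /Dx; apply: le_trans.
  by rewrite lef_pV2 ?posrE ?ltr0n// ler_nat ltnS.
have DU x : T x -> ~ C x -> exists n, D n x.
  move=> Tx nCx; have : nbhs x (~` C).
    by apply: open_nbhs_nbhs; split => //; exact: closed_openC.
  rewrite -nbhs_ballE => -[e /= e0 exC].
  have [n ne] := exists_invS_lt e0.
  exists n; split => // c Cc; rewrite leNgt; apply/negP => xc.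
  by apply: (exC c) => //; rewrite ballEmdist/= (lt_trans xc).
(* The points of D n have distance at least 1 / (n + 1) to C, the points of T
   outside D (n + 1) less than 1 / (n + 2). *)
have sep n A B : A `<=` D n -> B `<=` T `\` D n.+1 ->
    mu A + mu B <= mu (A `|` B).
  move=> AD BD; apply: (@mu_metric _ _ (n.+1%:R^-1 - n.+2%:R^-1)%R).
    by rewrite subr_gt0 ltf_pV2 ?posrE ?ltr0n// ltr_nat.
  move=> x y /AD[_ Dx] /BD[Ty /not_andP[//|/existsNP[c /not_implyP[Cc]]]].
  move=> /negP; rewrite -ltNge => yc; rewrite lerBlDr.
  rewrite (le_trans (Dx _ Cc))// (le_trans (metric_triangle x y c))//.
  by rewrite lerD2l ltW.
(* Every other layer D (n + 2) minus D (n + 1) is at positive distance from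
   the previous ones, so that the sum of their measures is at most mu T. *)
have sumD b m : \sum_(k < m) mu (D (k.*2 + b).+2 `\` D (k.*2 + b).+1) <=
    mu (D (m.*2 + b)%N).
  elim: m => [|m IH]; first by rewrite big_ord0 outer_measure_ge0.
  rewrite big_ord_recr/= (le_trans (leeD2r _ IH))//.
  rewrite (le_trans (sep (m.*2 + b)%N _ _ _ _))//.
    by move=> x [[Tx ?] ?].
  by apply: le_outer_measure; rewrite doubleS !addSn subUset; split;
    [exact/DS/leqW/leqW|move=> x []].
have sumT b : \sum_(k <oo) mu (D (k.*2 + b).+2 `\` D (k.*2 + b).+1) <= mu T.
  apply: lime_le.
    by apply: is_cvg_nneseries => n _ _; exact: outer_measure_ge0.
  by apply: nearW => m; rewrite big_mkord (le_trans (sumD b m))// muI.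
(* The two families of layers, one of each parity, put together in pairs. *)
pose G k := D (k.*2).+3 `\` D (k.*2).+1.
have Goo : \sum_(k <oo) mu (G k) < +oo.
  rewrite (@le_lt_trans _ _ (mu T + mu T))//; last by rewrite lte_add_pinfty.
  rewrite (le_trans _ (leeD (sumT 0%N) (sumT 1%N)))//.
  rewrite -nneseriesD; [|by move=> *; exact: outer_measure_ge0..].
  apply: lee_nneseries => [*|k _]; first exact: outer_measure_ge0.
  rewrite (le_trans _ (outer_measureU2 _ _ _))// addn0 addn1.
  apply: le_outer_measure => x [Dx nDx].
  by have [|] := pselect (D (k.*2).+2 x); [left|right].
have tail0 := nneseries_tail_cvg Goo (fun k _ => outer_measure_ge0 mu (G k)).
have TC n : T `&` ~` C `<=` D (n.*2).+1 `|` \bigcup_(k in ~` `I_n) G k.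
  move=> x [Tx /(DU _ Tx)[m Dm]].
  have [|nDx] := pselect (D (n.*2).+1 x); first by left.
  right; have ex : exists k, `[< D (k.*2).+1 x >].
    by exists m; apply/asboolP; apply: DS Dm; rewrite -addnn leqW// leq_addr.
  case: (ex_minnP ex) => k /asboolP Dk kmin.
  have nk : (n < k)%N.
    by rewrite ltnNge; apply/negP => kn; apply: nDx; apply: DS Dk;
      rewrite ltnS leq_double.
  case: k Dk kmin nk => [//|k] Dk kmin nk; exists k.
    by apply/negP; rewrite -leqNgt.
  by split => [|/asboolP/kmin]; [rewrite -doubleS|rewrite ltnn].
(* Up to the tail of a convergent series, D (2 n + 1) exhausts T minus C. *)
have main n : mu (T `&` C) + mu (T `&` ~` C) <=
    mu T + \sum_(n <= k <oo) mu (G k).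
  apply: (@le_trans _ _ (mu (T `&` C) +
      (mu (D (n.*2).+1) + \sum_(n <= k <oo) mu (G k)))).
    rewrite leeD2l// (le_trans (le_outer_measure _ _ _ (TC n)))//.
    rewrite (le_trans (outer_measureU2 _ _ _))// leeD2l//.
    exact: outer_measure_sigma_subadditive_tail.
  rewrite addeA leeD2r// addeC.
  have Dn0 : (0 < (n.*2.+1).+1%:R^-1 :> R)%R by rewrite invr_gt0 ltr0n.
  apply: (le_trans (mu_metric Dn0 _)).
    by move=> x y [_ Dx] [_ Cy]; exact: Dx.
  by apply: muI; rewrite subUset; split => // x [].
have : (fun n => mu T + \sum_(n <= k <oo) mu (G k)) @ \oo --> mu T + 0.
  apply: cvgeD => //; last exact: cvg_cst.
  by rewrite fin_num_adde_defl.
rewrite adde0 => cvgT; rewrite -(cvg_lim _ cvgT)//.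
apply: lime_ge; first by apply/cvg_ex; eexists; exact: cvgT.
exact: nearW.
Qed.

Lemma metric_outer_measure_borel : borel_measure mu.
Proof.
apply: smallest_sub => [|U oU].
  split; first exact: caratheodory_measurable_set0.
  - move=> A mA; rewrite setTD; exact: caratheodory_measurable_setC.
  - exact: caratheodory_measurable_bigcup.
rewrite -(setCK U); apply: caratheodory_measurable_setC.
exact/metric_outer_measure_closed/open_closedC.
Qed.

End criterion.

Lemma pullback_borel {R : realType} {X : metricType R} {Y : Type} (E : set X)
    (f : X -> Y) (nu : {outer_measure set Y -> \bar R}) :
  borel_measure (pullback E f nu).
Proof.
apply: metric_outer_measure_borel => A B r r0 AB.
rewrite /= /pullback setIUl.
apply: (@caratheodory_construction_metric _ _ _ _ _ _ _ r) => //.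
- by move=> S; exact: outer_measure_ge0.
- by move=> x y [Ax _] [By _]; exact: AB.
Qed.
(** * Regularity and tightness of finite Borel measures *)

Section borel_sets.
Context {R : realType} {X : pmetricType R}.
Implicit Types (A B : set X) (F : (set X)^nat).

Let T := g_sigma_algebraType (@open X).

Lemma borel_open A : open A -> borel X A.
Proof. by move=> oA; exact: sub_sigma_algebra. Qed.

Lemma borelC A : borel X A -> borel X (~` A).
Proof. exact: (@measurableC _ T). Qed.

Lemma borel_closed A : closed A -> borel X A.
Proof.
by move=> cA; rewrite -(setCK A); 
  apply: borelC; apply: borel_open; exact: closed_openC.
Qed.

Lemma borelI A B : borel X A -> borel X B -> borel X (A `&` B).
Proof. exact: (@measurableI _ T). Qed.

Lemma borelD A B : borel X A -> borel X B -> borel X (A `\` B).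
Proof. by move=> bA bB; rewrite setDE; apply: borelI => //; exact: borelC. Qed.

Lemma borel_bigcup F : (forall n, borel X (F n)) -> borel X (\bigcup_n F n).
Proof. exact: (@bigcupT_measurable _ T). Qed.

Lemma borel_seqDU F n : (forall n, borel X (F n)) -> borel X (seqDU F n).
Proof. by move=> bF; exact: (@seqDU_measurable _ T). Qed.

Lemma ball_mdist_open (x : X) (r : R) : open (ball x r).
Proof.
rewrite openE => y; rewrite ballEmdist/= => xy.
rewrite /interior -nbhs_ballE; exists (r - mdist x y)%R => /=.
  by rewrite subr_gt0.
move=> z; rewrite !ballEmdist/= => yz.
by rewrite (le_lt_trans (metric_triangle x y z))// -ltrBrDl.
Qed.

End borel_sets.

(** Continuity from above at the empty set, for measurable sets. *)
Lemma caratheodory_cvg0 {R : realType} {T : pointedType}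
    (mu : {outer_measure set T -> \bar R}) (A : (set T)^nat) (e : R) :
  (0 < e)%R -> (forall n, mu.-caratheodory (A n)) ->
  (forall n m, (n <= m)%N -> A m `<=` A n) -> \bigcap_n A n = set0 ->
  mu (A 0%N) < +oo -> exists n, mu (A n) <= e%:E.
Proof.
move=> e0 mA ndA A0 Aoo.
pose m := mu : set (caratheodory_type mu) -> \bar R.
have : (m \o A) @ \oo --> m (\bigcap_n A n).
  apply: nonincreasing_cvg_mu => //; first exact: bigcapT_measurable.
  by move=> i j ij; apply/subsetPset; exact: ndA.
rewrite A0 [m set0]outer_measure0 => mA0.
apply: contrapT => /forallNP mAe.
have : e%:E <= 0.
  apply: (cvge_ge _ mA0); apply: nearW => n; apply/ltW; rewrite ltNge.
  by apply/negP; exact: mAe.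
by rewrite lee_fin leNgt e0.
Qed.

Section regularity.
Context {R : realType} {X : pmetricType R}.
Variable mu : {outer_measure set X -> \bar R}.
Hypothesis mu_borel : borel_measure mu.

Section finite.
Variable O : set X.
Hypotheses (bO : borel X O) (Ooo : mu O < +oo).

(** Sets approximable inside [O] by closed sets from within and by open sets
    from without; they form a sigma-algebra containing the open sets. *)
Let reg (B : set X) := forall e : R, (0 < e)%R -> exists C U : set X,
  [/\ closed C, open U, C `<=` B, B `<=` U & mu ((U `\` C) `&` O) <= e%:E].

Let regC A : reg A -> reg (~` A).
Proof.
move=> rA e /rA[C [U [cC oU CA AU CUe]]].
exists (~` U), (~` C); split.
- exact: open_closedC.
- exact: closed_openC.
- exact: subsetC.
- exact: subsetC.
- by rewrite (_ : ~` C `\` ~` U = U `\` C)// !setDE setCK setIC.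
Qed.

Let small (A : (set X)^nat) (e : R) : (0 < e)%R -> (forall n, borel X (A n)) ->
  (forall n m, (n <= m)%N -> A m `<=` A n) -> \bigcap_n A n = set0 ->
  exists n, mu (A n `&` O) <= e%:E.
Proof.
move=> e0 bA ndA A0; apply: caratheodory_cvg0 => //.
- by move=> n; apply: mu_borel; exact: borelI.
- by move=> n m nm; apply: setSI; exact: ndA.
- by rewrite -subset0 -A0 => x Ax n _; case: (Ax n).
- by rewrite (le_lt_trans _ Ooo)//; apply: le_outer_measure; exact: subIsetr.
Qed.

Let reg_bigcup (A : (set X)^nat) : (forall n, reg (A n)) -> reg (\bigcup_n A n).
Proof.
move=> rA e e0.
have e20 : (0 < e / 2)%R by rewrite divr_gt0.
pose P n (CU : set X * set X) := [/\ closed CU.1, open CU.2, CU.1 `<=` A n,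
  A n `<=` CU.2 & mu ((CU.2 `\` CU.1) `&` O) <= (e / 2 / (2 ^ n.+1)%:R)%:E].
have [CU PCU] : {CU : nat -> set X * set X & forall n, P n (CU n)}.
  apply: (@choice _ _ P) => n.
  have [|C [U CU]] := rA n (e / 2 / (2 ^ n.+1)%:R)%R; last by exists (C, U).
  by rewrite divr_gt0// ltr0n expn_gt0.
pose C := \bigcup_n (CU n).1.
pose D n := \bigcup_(k in `I_n) (CU k).1.
have cD n : closed (D n).
  by apply: closed_bigcup => // k _; have [] := PCU k.
have [n Dn] : exists n, mu ((C `\` D n) `&` O) <= (e / 2)%:E.
  apply: small => //.
  - move=> n; apply: borelD; last exact: borel_closed.
    by apply: borel_bigcup => k; apply: borel_closed; have [] := PCU k.
  - move=> n m nm; apply: setDS => x [k /= kn Ck].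
    by exists k => //=; exact: leq_trans nm.
  - rewrite -subset0 => x CDx; have [[k _ Ck] _] := CDx 0%N Logic.I.
    by have [_] := CDx k.+1 Logic.I; apply; exists k => /=.
exists (D n), (\bigcup_n (CU n).2); split => //.
- by apply: bigcup_open => k _; have [] := PCU k.
- by move=> x [k _ Ck]; exists k => //; have [_ _ + _ _] := PCU k; exact.
- by move=> x [k _ Ak]; exists k => //; have [_ _ _ + _] := PCU k; exact.
rewrite (@le_trans _ _ (mu (\bigcup_n (((CU n).2 `\` (CU n).1) `&` O) `|`
    ((C `\` D n) `&` O))))//.
  apply: le_outer_measure => x [[[k _ Ukx] nDx] Ox].
  have [Cx|nCx] := pselect (C x); first by right.
  by left; exists k => //; split => //; split => // Ckx; apply: nCx; exists k.
rewrite (le_trans (outer_measureU2 _ _ _))// (splitr e) EFinD leeD//.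
rewrite (le_trans (outer_measure_sigma_subadditive _ _))//.
rewrite (le_trans _ (epsilon_trick0 xpredT (ltW e20)))//.
apply: lee_nneseries => [k _ _|k _]; first exact: outer_measure_ge0.
by have [] := PCU k.
Qed.

Let reg_open U : open U -> reg U.
Proof.
move=> oU e e0.
(* The points at distance at least 1 / (n + 1) from the complement of U. *)
pose C n := [set x | forall y, ~ U y -> (n.+1%:R^-1 <= mdist x y)%R].
have cC n : closed (C n).
  rewrite -openC; rewrite openE => x /existsNP[y /not_implyP[nUy /negP]].
  rewrite -ltNge => xy; rewrite /interior -nbhs_ballE.
  exists (n.+1%:R^-1 - mdist x y)%R => /=; first by rewrite subr_gt0.
  move=> z; rewrite ballEmdist/= => xz /(_ y nUy).
  rewrite leNgt => /negP; apply.
  rewrite (le_lt_trans (metric_triangle z x y))// -ltrBrDr metric_sym.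
  exact: xz.
have CU n : C n `<=` U.
  by move=> x Cx; apply: contrapT => /Cx; rewrite mdistxx leNgt invr_gt0 ltr0n.
have [n Cn] : exists n, mu ((U `\` C n) `&` O) <= e%:E.
  apply: small => //.
  - by move=> n; apply: borelD; [exact: borel_open|exact: borel_closed].
  - move=> n m nm; apply: setDS => x Cx y /Cx; apply: le_trans.
    by rewrite lef_pV2 ?posrE ?ltr0n// ler_nat ltnS.
  - rewrite -subset0 => x UCx; have [Ux _] := UCx 0%N Logic.I.
    have : nbhs x U by exact: open_nbhs_nbhs.
    rewrite -nbhs_ballE => -[r /= r0 rU].
    have [n nr] := exists_invS_lt r0.
    have [_] := UCx n Logic.I; apply => y nUy; rewrite leNgt; apply/negP => xy.
    by case: nUy; apply: rU; rewrite ballEmdist/= (lt_trans xy).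
by exists (C n), U; split; [exact: cC|exact: oU|exact: CU|exact: subset_refl|].
Qed.

Lemma finite_borel_regular B (e : R) : borel X B -> (0 < e)%R ->
  exists C U : set X,
    [/\ closed C, open U, C `<=` B, B `<=` U & mu ((U `\` C) `&` O) <= e%:E].
Proof.
move=> bB e0; suff : reg B by exact.
move: bB; apply: smallest_sub => [|U]; last exact: reg_open.
split.
- move=> r r0; exists set0, set0; split => //;
    [exact: closed0|exact: open0|].
  by rewrite set0D set0I outer_measure0 lee_fin ltW.
- by move=> A rA; rewrite setTD; exact: regC.
- exact: reg_bigcup.
Qed.

End finite.

Hypothesis mu_bounded : finite_on_bounded mu.

Lemma mu_ball_lty x (r : R) : mu (ball x r) < +oo.
Proof. by apply: mu_bounded; exact: diam_ball_lty. Qed.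

(** The open set is kept inside the ball, where the measure is finite. *)
Lemma outer_regular B x (r e : R) : borel X B -> B `<=` ball x r ->
  (0 < e)%R -> exists U, [/\ open U, B `<=` U & mu U <= mu B + e%:E].
Proof.
move=> bB Br e0; have bb : borel X (ball x r).
  apply: borel_open; exact: ball_mdist_open.
have [C [U [cC oU CB BU UCe]]] :=
  finite_borel_regular bb (mu_ball_lty x r) bB e0.
exists (U `&` ball x r); split.
- by apply: openI => //; exact: ball_mdist_open.
- by move=> y By; split; [exact: BU|exact: Br].
rewrite (@le_trans _ _ (mu (C `|` ((U `\` C) `&` ball x r))))//.
  apply: le_outer_measure => y [Uy ry].
  by have [|nCy] := pselect (C y); [left|right].
rewrite (le_trans (outer_measureU2 _ _ _))// leeD//.
exact: le_outer_measure.
Qed.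

End regularity.

Lemma separable_seq {R : realType} {X : pmetricType R} :
  separable_space X -> exists d : nat -> X,
    forall x (r : R), (0 < r)%R -> exists i, ball (d i) r x.
Proof.
move=> [D [/countable_injP[g ginj] dD]].
exists (fun n => xget point [set x | D x /\ g x = n]) => x r r0.
have [|y [xy Dy]] := dD (ball x r) _ (ball_mdist_open x r).
  by exists x; exact: ballxx.
exists (g y).
have [Dz] := xgetPex point
  (ex_intro [set z | D z /\ g z = g y] y (conj Dy erefl)).
by move=> /ginj ->; rewrite ?inE//; exact: ball_sym.
Qed.

(** In a complete space, closed and totally bounded sets are compact: an
    ultrafilter on such a set contains balls of every radius, hence is
    Cauchy. *)
Lemma totally_bounded_compact {R : realType} {X : completeMetricType R}
    (K : set X) : closed K ->
  (forall r : R, (0 < r)%R -> exists (d : nat -> X) (n : nat),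
    K `<=` \bigcup_(i in `I_n) ball (d i) r) -> compact K.
Proof.
move=> cK tK; rewrite compact_ultra => F UF FK.
have : cauchy F.
  apply: cauchy_exP => r r0; have [d [n Kd]] := tK _ r0.
  apply: contrapT => /forallNP nF.
  have FC i : F (~` ball (d i) r).
    by have [/nF|] := in_ultra_setVsetC (ball (d i) r) UF.
  have FI : forall m, F (\bigcap_(i in `I_m) ~` ball (d i) r).
    elim=> [|m IH]; first by rewrite II0 bigcap_set0; exact: filterT.
    rewrite IIS bigcap_setU bigcap_set1; exact: filterI.
  have [x [Kx]] := filter_ex (filterI FK (FI n)).
  by have [i In ix] := Kd x Kx => /(_ i In).
move=> /cauchy_cvg /cvg_ex[p Fp]; exists p; split => //.
apply: cK => B /Fp FB; have [x [Kx Bx]] := filter_ex (filterI FK FB).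
by exists x.
Qed.

(** Ulam's theorem: a Borel measure on a complete separable metric space that
    is finite on bounded sets is tight on bounded Borel sets. *)
Section tightness.
Context {R : realType} {X : completeMetricType R}.
Hypothesis sepX : separable_space X.
Variable mu : {outer_measure set X -> \bar R}.
Hypotheses (mu_borel : borel_measure mu) (mu_bounded : finite_on_bounded mu).

Lemma compact_approx B x (r e : R) : borel X B -> B `<=` ball x r ->
  (0 < e)%R -> exists K, [/\ compact K, K `<=` B & mu (B `\` K) <= e%:E].
Proof.
move=> bB Br e0; have e20 : (0 < e / 2)%R by rewrite divr_gt0.
pose O := ball x r.
have bO : borel X O by apply: borel_open; exact: ball_mdist_open.
have Ooo : mu O < +oo by exact: mu_ball_lty.
have [C [U [cC oU CB BU UCe]]] := finite_borel_regular mu_borel bO Ooo bB e20.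
have [d dX] := separable_seq sepX.
(* Finitely many balls of radius 1 / (k + 1) cover O up to a small set. *)
pose W k n := \bigcup_(i in `I_n) ball (d i) (k.+1%:R^-1 : R).
have oW k n : open (W k n).
  by apply: bigcup_open => i _; exact: ball_mdist_open.
have ex k : exists n, mu (O `\` W k n) <= (e / 2 / (2 ^ k.+1)%:R)%:E.
  apply: caratheodory_cvg0.
  - by rewrite divr_gt0// ltr0n expn_gt0.
  - by move=> n; apply: mu_borel; apply: borelD => //; exact: borel_open.
  - move=> n m nm; apply: setDS => y [i /= In iy].
    by exists i => //=; exact: leq_trans nm.
  - rewrite -subset0 => y Wy.
    have [i iy] : exists i, ball (d i) (k.+1%:R^-1 : R) y.
      by apply: dX; rewrite invr_gt0 ltr0n.
    by have [_] := Wy i.+1 Logic.I; apply; exists i => /=.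
  - by rewrite (le_lt_trans _ Ooo)//; apply: le_outer_measure => y [].
have [n nP] := choice ex.
pose K := C `&` \bigcap_k closure (W k (n k)).
exists K; split; last 1 first.
- rewrite (@le_trans _ _ (mu (((U `\` C) `&` O) `|`
      \bigcup_k (O `\` W k (n k)))))//.
    apply: le_outer_measure => y [By nKy].
    have [Cy|nCy] := pselect (C y).
      right; have : ~ (\bigcap_k closure (W k (n k))) y.
        by move=> Wy; apply: nKy.
      move=> /existsNP[k /not_implyP[_ nWy]]; exists k => //.
      by split; [exact: Br|move=> /subset_closure].
    by left; split; [split => //; exact: BU|exact: Br].
  rewrite (le_trans (outer_measureU2 _ _ _))// (splitr e) EFinD leeD//.
  rewrite (le_trans (outer_measure_sigma_subadditive _ _))//.
  rewrite (le_trans _ (epsilon_trick0 xpredT (ltW e20)))//.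
  by apply: lee_nneseries => [k _ _|k _]; first exact: outer_measure_ge0.
- apply: totally_bounded_compact.
    by apply: closedI => //; apply: closed_bigI => k _; exact: closed_closure.
  move=> s s0; have s20 : (0 < s / 2)%R by rewrite divr_gt0.
  have [k ks] := exists_invS_lt s20.
  exists d, (n k) => y [_ /(_ k Logic.I) Wy].
  have [z [[i In iz] yz]] := Wy _ (nbhsx_ballx y _ s20).
  exists i => //; rewrite [s]splitr; apply: (@ball_triangle _ _ z).
    by apply: le_ball iz; exact: ltW.
  exact: ball_sym.
- by move=> y [/CB].
Qed.

(** Up to a null set, a bounded Borel set is a countable union of compact
    sets. *)
Lemma compact_exhaustion B x (r : R) : borel X B -> B `<=` ball x r ->
  exists K : (set X)^nat,
    [/\ forall n, compact (K n), forall n, K n `<=` B &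
        mu (B `\` \bigcup_n K n) = 0].
Proof.
move=> bB Br.
have ex n : exists K,
    [/\ compact K, K `<=` B & mu (B `\` K) <= (n.+1%:R^-1)%:E].
  by apply: (compact_approx bB Br); rewrite invr_gt0 ltr0n.
have [K KP] := choice ex.
exists K; split => [n|n|]; [by have [] := KP n|by have [] := KP n|].
apply/eqP; rewrite eq_le outer_measure_ge0 andbT.
apply/lee_addgt0Pr => e e0; rewrite add0e.
have [n ne] := exists_invS_lt e0.
have [_ _ Kn] := KP n.
rewrite (le_trans _ (le_trans Kn _))//; last by rewrite lee_fin ltW.
by apply: le_outer_measure; apply: setDS; exact: bigcup_sup.
Qed.

End tightness.
(** * Measurability of images *)

Section outer_measure_null.
Context {R : realType} {T : Type}.
Variable mu : {outer_measure set T -> \bar R}.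

Lemma outer_measure_le0 (A : set T) : mu A <= 0 -> mu A = 0.
Proof. by move=> A0; apply/eqP; rewrite eq_le A0 outer_measure_ge0. Qed.

Lemma outer_measure_subnull (A B : set T) : A `<=` B -> mu B = 0 -> mu A = 0.
Proof.
by move=> AB B0; apply: outer_measure_le0; rewrite -B0 le_outer_measure.
Qed.

Lemma null_caratheodory (A : set T) : mu A = 0 -> mu.-caratheodory A.
Proof.
move=> A0; apply: le_caratheodory_measurable => Z.
rewrite (@outer_measure_subnull (Z `&` A) A)// add0e.
by apply: le_outer_measure; exact: subIsetl.
Qed.

Lemma outer_measure_bigcup0 (A : (set T)^nat) :
  (forall n, mu (A n) = 0) -> mu (\bigcup_n A n) = 0.
Proof.
move=> A0; apply: outer_measure_le0.
by rewrite (le_trans (outer_measure_sigma_subadditive _ _))// eseries0.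
Qed.

Lemma outer_measureU0 (A B : set T) : mu A = 0 -> mu B = 0 -> mu (A `|` B) = 0.
Proof.
move=> A0 B0; apply: outer_measure_le0.
by rewrite (le_trans (outer_measureU2 _ _ _))// A0 B0 adde0.
Qed.

Lemma le_outer_measure_setD0 (A B : set T) : mu (A `\` B) = 0 -> mu A <= mu B.
Proof.
move=> AB0; rewrite -[leRHS]adde0 -AB0 (le_trans _ (outer_measureU2 _ _ _))//.
by apply: le_outer_measure => x Ax; have [|] := pselect (B x); [left|right].
Qed.

Lemma outer_measure_setD0 (A B : set T) : mu.-caratheodory A -> A `<=` B ->
  mu A < +oo -> mu B <= mu A -> mu (B `\` A) = 0.
Proof.
move=> mA AB Aoo BA; apply: outer_measure_le0.
have fA : mu A \is a fin_num by rewrite ge0_fin_numE// outer_measure_ge0.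
move: BA; rewrite (mA B) (setIidr AB) -setDE -[leRHS]adde0.
by rewrite leeD2lE.
Qed.

End outer_measure_null.

(** A countable family as a sequence of families with at most one member. *)
Lemma countable_singletons {T : Type} (G : set T) : countable G ->
  exists J : (set T)^nat, [/\ G = \bigcup_n J n, trivIset setT J &
    forall n, J n = set0 \/ exists x, J n = [set x]].
Proof.
move=> /countable_injP[g ginj].
exists (fun n => [set x | G x /\ g x = n]); split.
- by apply/seteqP; split => [x Gx|x [n _ []//]]; exists (g x).
- by move=> i j _ _ [x [[_ <-] [_ <-]]].
move=> n; have [[x [Gx gx]]|nx] := pselect (exists x, G x /\ g x = n).
  right; exists x; apply/seteqP; split => [y [Gy gy]|_ ->//].
  by apply: ginj; rewrite ?inE// gx.
by left; rewrite -subset0 => x Gx; apply: nx; exists x.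
Qed.

Lemma outer_measure_bigcup_le_esum {R : realType} {T : choiceType} {U : Type}
    (mu : {outer_measure set U -> \bar R}) (G : set T) (h : T -> set U) :
  countable G -> mu (\bigcup_(x in G) h x) <= \esum_(x in G) mu (h x).
Proof.
move=> /countable_singletons[J [-> tJ J1]].
have h0 x : 0 <= mu (h x) by exact: outer_measure_ge0.
rewrite esum_bigcupT// -nneseries_esumT; last first.
  by move=> n; exact: esum_ge0.
rewrite bigcup_bigcup (le_trans (outer_measure_sigma_subadditive _ _))//.
apply: lee_nneseries => [n _ _|n _]; first exact: outer_measure_ge0.
have [->|[x ->]] := J1 n; first by rewrite bigcup_set0 esum_set0 outer_measure0.
by rewrite bigcup_set1 esum_set1.
Qed.

Lemma countable_esumZl {R : realType} {T : choiceType} (G : set T)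
    (a : T -> \bar R) (c : R) : countable G -> (forall x, 0 <= a x) ->
  (0 <= c)%R -> \esum_(x in G) (c%:E * a x) = c%:E * \esum_(x in G) a x.
Proof.
move=> /countable_singletons[J [-> tJ J1]] a0 c0.
have ca0 x : 0 <= c%:E * a x by rewrite mule_ge0.
rewrite !esum_bigcupT// -!nneseries_esumT; [|by move=> *; exact: esum_ge0..].
rewrite -nneseriesZl => [|n _]; last exact: esum_ge0.
apply: eq_eseriesr => n _.
by have [->|[x ->]] := J1 n; rewrite ?esum_set0 ?mule0 ?esum_set1.
Qed.

(** Additivity over a countable disjoint family, written as an unordered
    sum. *)
Lemma caratheodory_bigcup_esum {R : realType} {T : pointedType}
    (mu : {outer_measure set T -> \bar R}) (G : set (set T)) :
  countable G -> trivIset G id -> (forall S, G S -> mu.-caratheodory S) ->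
  \esum_(S in G) mu S = mu (\bigcup_(S in G) S).
Proof.
move=> cG tG mG; have [J [GJ tJ J1]] := countable_singletons cG.
have mu0 S : 0 <= mu S by exact: outer_measure_ge0.
have JG n : J n `<=` G by rewrite GJ; exact: bigcup_sup.
pose A n := \bigcup_(S in J n) S.
have mA n : mu.-caratheodory (A n).
  rewrite /A; have := JG n.
  have [->|[S ->]] := J1 n; rewrite ?bigcup_set0 ?bigcup_set1 => SG.
    exact: caratheodory_measurable_set0.
  exact/mG/SG.
have tA : trivIset setT A.
  move=> i j _ _ [x [[S Si Sx] [S' Sj S'x]]].
  have SS' : S = S' by apply: tG; [exact: JG Si|exact: JG Sj|exists x].
  by apply: tJ => //; exists S; split => //; rewrite SS'.
rewrite GJ esum_bigcupT// bigcup_bigcup -/A.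
rewrite -nneseries_esumT; last by move=> n; exact: esum_ge0.
have := @measure_semi_bigcup _ _ _
  (mu : set (caratheodory_type mu) -> \bar R) A.
move=> ->//; last exact: caratheodory_measurable_bigcup.
apply: eq_eseriesr => n _; rewrite /A.
by have [->|[S ->]] := J1 n;
  rewrite ?bigcup_set0 ?bigcup_set1 ?esum_set0 ?esum_set1.
Qed.

Section borel_subspace.
Context {R : realType} {X : pmetricType R}.
Variables (E : set X).

Lemma borel_subspaceI B : borel X B -> borel_subspace E (B `&` E).
Proof.
move: B; apply: smallest_sub => [|U oU].
  have [e0 eC eU] := smallest_sigma_algebra E [set U `&` E | U in @open X].
  split => [|A eA|A eA].
  - by rewrite set0I.
  - by rewrite setTD -[X in borel_subspace _ X](_ : E `\` (A `&` E) = _);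
      [exact: eC|rewrite setDIr setDv setU0 setIC -setDE].
  - by rewrite setI_bigcupl; exact: eU.
by apply: sub_sigma_algebra; exists U.
Qed.

End borel_subspace.

Section borel_kernel.
Context {R : realType} {X : pmetricType R}.
Variable mu : {outer_measure set X -> \bar R}.
Hypotheses (mu_regular : borel_regular mu) (mu_bounded : finite_on_bounded mu).

Lemma bigcup_balls : \bigcup_n ball (point : X) (n%:R : R) = setT.
Proof.
apply/seteqP; split => // x _; exists (Num.truncn (mdist point x)).+1 => //.
by rewrite ballEmdist/=; exact: truncnS_gt.
Qed.

(** The kernel of [A] is the complement in the ball of a Borel hull of the
    complement. *)
Let borel_kernel_bounded A x (r : R) : mu.-caratheodory A -> A `<=` ball x r ->
  exists B, [/\ borel X B, B `<=` A & mu (A `\` B) = 0].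
Proof.
move=> mA Ar; have [mu_borel mu_hull] := mu_regular.
have bb : borel X (ball x r) by apply: borel_open; exact: ball_mdist_open.
have [H [bH HA muH]] := mu_hull (ball x r `\` A).
exists (ball x r `\` H); split; first exact: borelD.
  by move=> y [ry nHy]; apply: contrapT => nAy; apply: nHy; exact: HA.
have H0 : mu (H `\` (ball x r `\` A)) = 0.
  apply: outer_measure_setD0 => //; last by rewrite muH.
    apply: caratheodory_measurable_setD => //; exact: mu_borel.
  rewrite (le_lt_trans (le_outer_measure _ _ (ball x r) _))//.
  exact: mu_ball_lty.
apply: outer_measure_subnull H0 => y [Ay nHy]; split; last by case.
by apply: contrapT => nH; apply: nHy; split => //; exact: Ar.
Qed.

(** A measurable set is a Borel set up to a null set. *)
Lemma borel_kernel A : mu.-caratheodory A ->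
  exists B, [/\ borel X B, B `<=` A & mu (A `\` B) = 0].
Proof.
move=> mA; have [mu_borel _] := mu_regular.
have ex n : exists B, [/\ borel X B, B `<=` A `&` ball point (n%:R : R) &
    mu ((A `&` ball point (n%:R : R)) `\` B) = 0].
  apply: (@borel_kernel_bounded _ point n%:R) => [|y []//].
  apply: caratheodory_measurable_setI => //; apply: mu_borel.
  by apply: borel_open; exact: ball_mdist_open.
have [B BP] := choice ex.
exists (\bigcup_n B n); split.
- by apply: borel_bigcup => n; have [] := BP n.
- by move=> y [n _]; have [_ + _] := BP n => /[apply] -[].
apply: (@outer_measure_subnull _ _ _ _
    (\bigcup_n ((A `&` ball point (n%:R : R)) `\` B n))).
  move=> y [Ay nBy]; have : [set: X] y by [].
  rewrite -bigcup_balls => -[n _ ny]; exists n => //; split => // Bny.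
  by apply: nBy; exists n.
by apply: outer_measure_bigcup0 => n; have [] := BP n.
Qed.

(** An absolutely continuous measure for which Borel sets are measurable has
    at least as many measurable sets. *)
Lemma caratheodory_ac (psi : {outer_measure set X -> \bar R}) :
  borel_measure psi -> abs_continuous psi mu ->
  mu.-caratheodory `<=` psi.-caratheodory.
Proof.
move=> psi_borel ac A mA; have [B [bB BA AB0]] := borel_kernel mA.
rewrite -(setDUK BA); apply: caratheodory_measurable_setU.
  exact: psi_borel.
by apply: null_caratheodory; exact: ac.
Qed.

End borel_kernel.

Section image.
Context {R : realType} {X : completeMetricType R} {Y : pmetricType R}.
Variables (mu : {outer_measure set X -> \bar R})
  (nu : {outer_measure set Y -> \bar R}) (E : set X) (f : X -> Y).
Hypotheses (sepX : separable_space X)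
  (mu_regular : borel_regular mu)
  (mu_bounded : finite_on_bounded mu)
  (nu_borel : borel_measure nu)
  (f_continuous : {within E, continuous f})
  (pullback_bounded : finite_on_bounded (pullback E f nu))
  (pullback_ac : abs_continuous (pullback E f nu) mu).

Lemma image_le_delta delta (S : set X) : nu (f @` S) <=
  caratheodory_delta (borel_subspace E) (fun S => nu (f @` S)) delta S.
Proof.
apply: le_ereal_inf_tmp => _ [G [_ cG _ SG] <-].
rewrite (le_trans _ (outer_measure_bigcup_le_esum nu _ cG))//.
apply: le_outer_measure => _ [x Sx <-].
by have [B GB Bx] := SG x Sx; exists B => //; exists x.
Qed.

(** In particular, sets that are null for the pull-back have null images. *)
Lemma image_le_pullback (S : set X) : S `<=` E ->
  nu (f @` S) <= pullback E f nu S.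
Proof.
move=> SE; rewrite (le_trans (image_le_delta 1 S))// /pullback.
rewrite (setIidl SE); apply: ereal_sup_ubound.
by exists 1%R => //=.
Qed.

Lemma image_compact_borel (K : set X) : compact K -> K `<=` E ->
  borel Y (f @` K).
Proof.
move=> cK KE; apply: borel_closed; apply: compact_closed.
  exact: metric_hausdorff.
by apply: continuous_compact => //; exact: continuous_subspaceW f_continuous.
Qed.

Lemma image_null (N : set X) : N `<=` E -> pullback E f nu N = 0 ->
  nu (f @` N) = 0.
Proof.
by move=> NE N0; apply: outer_measure_le0; rewrite -N0 image_le_pullback.
Qed.

Let image_bounded_borel B x (r : R) : borel X B -> B `<=` E ->
  B `<=` ball x r -> nu.-caratheodory (f @` B).
Proof.
move=> bB BE Br.
have [K [cK KB K0]] :=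
  compact_exhaustion sepX (@pullback_borel _ _ _ E f nu) pullback_bounded bB Br.
have UK : \bigcup_n K n `<=` B by move=> y [n _]; exact: KB.
rewrite -(setDUK UK) image_setU image_bigcup.
apply: caratheodory_measurable_setU.
  apply: caratheodory_measurable_bigcup => n; apply: nu_borel.
  by apply: image_compact_borel => // y Ky; exact/BE/(KB n).
apply: null_caratheodory; apply: image_null => // y [By _].
exact: BE.
Qed.

(** Images of measurable sets are measurable: up to a null set, whose image
    is null, a measurable set is a countable union of compact sets. *)
Lemma image_caratheodory A : mu.-caratheodory A -> A `<=` E ->
  nu.-caratheodory (f @` A).
Proof.
move=> mA AE; have [B [bB BA AB0]] := borel_kernel mu_regular mu_bounded mA.
rewrite -(setDUK BA) image_setU.
apply: caratheodory_measurable_setU; last first.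
  apply: null_caratheodory; apply: image_null; first by move=> y [/AE].
  exact: pullback_ac.
rewrite -(setIT B) -bigcup_balls setI_bigcupr image_bigcup.
apply: caratheodory_measurable_bigcup => n.
apply: (@image_bounded_borel _ point n%:R).
- by apply: borelI => //; apply: borel_open; exact: ball_mdist_open.
- by move=> y [/BA/AE].
- exact: subIsetr.
Qed.

End image.
(** * The pull-back measure as the integral of the multiplicity *)

Lemma le_counting {R : realType} {T U : choiceType} (A : set T) (B : set U) :
  (A #<= B)%card -> counting A <= counting B :> \bar R.
Proof.
move=> AB; rewrite /counting; case: (asboolP (finite_set B)) => [|_].
  2: by rewrite leey.
move=> finB; have finA := card_le_finite AB finB.
rewrite asboolT// lee_fin ler_nat; have [m Bm] := finB.
rewrite (card_fset_set Bm) geq_card_fset_set//.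
by rewrite -(card_le_eqr Bm).
Qed.

Lemma card_le_inj {T U : Type} (A : set T) (B : set U) (h : T -> U) :
  {in A &, injective h} -> (forall x, A x -> B (h x)) -> (A #<= B)%card.
Proof.
move=> hinj AB; rewrite -(card_le_eql (inj_card_eq hinj)).
by apply: subset_card_le => _ [x Ax <-]; exact: AB.
Qed.

Section partition.
Context {R : realType} {X : completeMetricType R}.
Hypothesis sepX : separable_space X.

(** A complete separable metric space has countable Borel partitions into
    arbitrarily small pieces. *)
Lemma small_borel_partition (r : R) : (0 < r)%R -> exists S : (set X)^nat,
  [/\ forall i, borel X (S i), trivIset setT S, \bigcup_i S i = setT &
      forall i, diam (S i) <= r%:E].
Proof.
move=> r0; have r20 : (0 < r / 2)%R by rewrite divr_gt0.
have [d dX] := separable_seq sepX.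
exists (seqDU (fun i => ball (d i) (r / 2)%R)); split.
- by move=> i; apply: borel_seqDU => j; apply: borel_open;
    exact: ball_mdist_open.
- exact: trivIset_seqDU.
- rewrite -seqDU_bigcup_eq; apply/seteqP; split => // x _.
  by have [i ix] := dX x _ r20; exists i.
- move=> i; apply: (le_trans (le_diam (subset_seqDU (A := _) (i := i)))).
  apply: diam_le => [|x y]; first exact: ltW.
  rewrite !ballEmdist/= => dx dy.
  rewrite (le_trans (metric_triangle x (d i) y))//.
  by rewrite metric_sym (splitr r) lerD// ltW.
Qed.

(** A finite set of points is eventually separated by the partitions. *)
Lemma finite_separated (F : {fset X}) : exists k : nat, forall m x y,
  (k <= m)%N -> x \in F -> y \in F -> (mdist x y <= m.+1%:R^-1)%R -> x = y.
Proof.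
have ex (p : X * X) : exists n, p.1 <> p.2 -> (n.+1%:R^-1 < mdist p.1 p.2)%R.
  have [->|/eqP] := eqVneq p.1 p.2; first by exists 0%N.
  move=> /eqP; rewrite -mdist_gt0 => /exists_invS_lt[n pn].
  by exists n.
have [n nP] := choice ex.
exists (\max_(x <- F) \max_(y <- F) n (x, y)) => m x y km xF yF xy.
apply: contrapT => /(nP (x, y)) /=; apply/negP; rewrite -leNgt.
rewrite (le_trans xy)// lef_pV2 ?posrE ?ltr0n// ler_nat ltnS.
rewrite (leq_trans _ km)//.
apply: leq_trans (@leq_bigmax_seq _ (enum_fset F) xpredT
  (fun x => \max_(y <- F) n (x, y)) x xF isT).
exact: (@leq_bigmax_seq _ (enum_fset F) xpredT (fun y => n (x, y)) y yF isT).
Qed.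

End partition.

Section area.
Context {R : realType} {X : completeMetricType R} {Y : pmetricType R}.
Variables (mu : {outer_measure set X -> \bar R})
  (nu : {outer_measure set Y -> \bar R}) (E : set X) (f : X -> Y).
Hypotheses (sepX : separable_space X)
  (mu_regular : borel_regular mu)
  (mu_bounded : finite_on_bounded mu)
  (nu_borel : borel_measure nu)
  (f_continuous : {within E, continuous f})
  (pullback_bounded : finite_on_bounded (pullback E f nu))
  (pullback_ac : abs_continuous (pullback E f nu) mu).

Let psi : {outer_measure set X -> \bar R} := pullback E f nu.

Variable A : set X.
Hypotheses (mA : mu.-caratheodory A) (AE : A `<=` E).

(** The number of pieces of a partition [S] of [A] whose image contains
    [y]. *)
Let hits (S : (set X)^nat) (y : Y) : \bar R :=
  counting [set i | (f @` (A `&` S i)) y].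

Let hitsE S y : hits S y = \sum_(i <oo) (\1_(f @` (A `&` S i)) y)%:E.
Proof.
rewrite /hits counting_dirac; apply: eq_eseriesr => i _.
by rewrite diracE indicE; congr ((nat_of_bool _)%:R%:E); apply/idP/idP;
  rewrite !inE.
Qed.

Section pieces.
Variable S : (set X)^nat.
Hypotheses (bS : forall i, borel X (S i)) (tS : trivIset setT S)
  (US : \bigcup_i S i = setT).

Let mAS i : mu.-caratheodory (A `&` S i).
Proof.
apply: caratheodory_measurable_setI => //.
by have [mu_borel _] := mu_regular; exact: mu_borel.
Qed.

Let mfAS i : nu.-caratheodory (f @` (A `&` S i)).
Proof. by apply: (image_caratheodory (E := E) (mu := mu)) => // x [/AE]. Qed.

(** Choosing a point of the fibre in each piece that is hit is injective. *)
Let hits_le y : hits S y <= multiplicity f A y.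
Proof.
rewrite /hits /multiplicity; apply: le_counting.
have ex i : exists x, (f @` (A `&` S i)) y -> [/\ A x, S i x & f x = y].
  have [[x [Ax Sx] fx]|n] := pselect ((f @` (A `&` S i)) y).
    by exists x.
  by exists point.
have [x xP] := choice ex.
apply: (card_le_inj (h := x)) => [i j|i /xP[Ax _ fx]//].
rewrite !inE => /xP[_ Si _] /xP[_ Sj _] xij.
by apply: tS => //; exists (x i); split => //; rewrite xij.
Qed.

Let measurable_hits :
  measurable_fun [set: caratheodory_type nu]
    (hits S : caratheodory_type nu -> \bar R).
Proof.
rewrite (_ : hits S = fun y => \sum_(i <oo) (\1_(f @` (A `&` S i)) y)%:E).
  2: by apply/funext => y; rewrite hitsE.
apply: (@ge0_emeasurable_sum _ (caratheodory_type nu) R setT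
  (fun i y => (\1_(f @` (A `&` S i)) y)%:E) xpredT) => [i y _ _|i _].
  by rewrite lee_fin.
by apply/measurable_EFinP; apply: measurable_indic; exact: mfAS.
Qed.

Let integral_hits :
  \int[nu : set (caratheodory_type nu) -> \bar R]_y hits S y =
  \sum_(i <oo) nu (f @` (A `&` S i)).
Proof.
under eq_integral do rewrite hitsE.
rewrite integral_nneseries//; last first.
  by move=> i; apply/measurable_EFinP; apply: measurable_indic; exact: mfAS.
apply: eq_eseriesr => i _; rewrite integral_indic ?setIT//.
exact: mfAS.
Qed.

(** The measure of an image is at most the pull-back of the set, and the
    pull-back is additive over the pieces. *)
Let integral_hits_le :
  \int[nu : set (caratheodory_type nu) -> \bar R]_y hits S y <= psi A.
Proof.
rewrite integral_hits (@le_trans _ _ (\sum_(i <oo) psi (A `&` S i)))//.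
  apply: lee_nneseries => [i _ _|i _]; first exact: outer_measure_ge0.
  by apply: image_le_pullback => x [/AE].
have mpsi : mu.-caratheodory `<=` psi.-caratheodory.
  apply: (caratheodory_ac mu_regular mu_bounded) => //.
  exact: pullback_borel.
rewrite -[in leRHS](setIT A) -US setI_bigcupr.
have := @measure_semi_bigcup _ _ _
  (psi : set (caratheodory_type psi) -> \bar R) (fun i => A `&` S i).
move=> -> //.
- by move=> i; exact/mpsi/mAS.
- exact: trivIset_setIl.
- by apply: bigcupT_measurable => i; exact/mpsi/mAS.
Qed.

(** A Borel set is covered by its intersections with the pieces. *)
Let delta_le_hits (r : R) B : (forall i, diam (S i) <= r%:E) ->
  borel X B -> B `<=` A ->
  caratheodory_delta (borel_subspace E) (fun S => nu (f @` S)) r B <=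
  \int[nu : set (caratheodory_type nu) -> \bar R]_y hits S y.
Proof.
move=> Sr bB BA; have nu0 T : 0 <= nu (f @` T) by exact: outer_measure_ge0.
rewrite -[in leLHS](setIT B) -US setI_bigcupr integral_hits.
rewrite (le_trans (caratheodory_delta_sigma_subadditive _ nu0 _ _))//.
apply: lee_nneseries => [i _ _|i _].
  by apply: le_ereal_inf_tmp => _ [G _ <-]; exact: esum_ge0.
apply: (@le_trans _ _ (nu (f @` (B `&` S i)))); last first.
  by apply: le_outer_measure; apply: image_subset; exact: setSI.
apply: ereal_inf_lbound; exists [set B `&` S i]; last by rewrite esum_set1.
split.
- move=> _ ->; rewrite -(@setIidl _ (B `&` S i) E); last by move=> x [/BA/AE].
  by apply: borel_subspaceI; exact: borelI.
- exact: countable1.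
- by move=> _ ->; apply: le_trans (Sr i); apply: le_diam; exact: subIsetr.
- by rewrite bigcup_set1.
Qed.

Lemma hits_properties : [/\ (forall y, hits S y <= multiplicity f A y),
  measurable_fun [set: caratheodory_type nu]
    (hits S : caratheodory_type nu -> \bar R),
  \int[nu : set (caratheodory_type nu) -> \bar R]_y hits S y <= psi A &
  forall (r : R) B, (forall i, diam (S i) <= r%:E) -> borel X B -> B `<=` A ->
  caratheodory_delta (borel_subspace E) (fun S => nu (f @` S)) r B <=
  \int[nu : set (caratheodory_type nu) -> \bar R]_y hits S y].
Proof. by split. Qed.

End pieces.

(** Once the pieces separate finitely many points of a fibre, the number of
    hits is at least the number of these points. *)
Let hits_cvg (S : nat -> (set X)^nat) y :
  (forall k, \bigcup_i S k i = setT) ->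
  (forall k i, diam (S k i) <= (k.+1%:R^-1)%:E) ->
  (forall k, hits (S k) y <= multiplicity f A y) ->
  (fun k => hits (S k) y) @ \oo --> multiplicity f A y.
Proof.
move=> US dS hS; set M := A `&` f @^-1` [set y].
have lb (F : {fset X}) : [set` F] `<=` M ->
    \forall k \near \oo, ((#|` F|)%fset%:R)%:E <= hits (S k) y.
  move=> FM; have [k0 sepF] := finite_separated F.
  near=> k; have k0k : (k0 <= k)%N by near: k; exists k0.
  have -> : ((#|` F|)%fset%:R)%:E = counting [set` F] :> \bar R.
    by rewrite /counting asboolT// set_fsetK.
  apply: le_counting.
  have ex x : exists i, S k i x.
    by have : setT x by []; rewrite -(US k) => -[i]; exists i.
  have [i iP] := choice ex.
  apply: (card_le_inj (h := i)) => [x x'|x /FM[Ax fx]]; last first.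
    by exists x => //; split.
  rewrite !inE => xF x'F ixx'; apply: (sepF k) => //.
  rewrite -lee_fin (le_trans _ (dS k (i x)))// mdist_le_diam//.
  by rewrite ixx'.
have [[n Mn]|infM] := pselect (finite_set M).
  have finM : finite_set M by exists n.
  apply: cvg_near_cst; have := lb (fset_set M).
  rewrite fset_setK// => /(_ (@subset_refl _ M)); apply: filterS => k hk.
  apply/eqP; rewrite eq_le hS/= (le_trans _ hk)//.
  by rewrite /multiplicity /counting asboolT.
rewrite /multiplicity /counting asboolF//; apply/cvgeyPge => r.
have [F FM Fr] := infinite_set_fset (Num.truncn r).+1 infM.
apply: filterS (lb F FM) => k; apply: le_trans; rewrite lee_fin.
by rewrite (le_trans (ltW (truncnS_gt r)))// ler_nat.
Unshelve. all: by end_near. Qed.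

Let ex_partitions : exists S : nat -> (set X)^nat,
  [/\ forall k i, borel X (S k i), forall k, trivIset setT (S k),
      forall k, \bigcup_i S k i = setT &
      forall k i, diam (S k i) <= (k.+1%:R^-1)%:E].
Proof.
have ex (k : nat) : exists S : (set X)^nat,
    [/\ forall i, borel X (S i), trivIset setT S, \bigcup_i S i = setT &
        forall i, diam (S i) <= (k.+1%:R^-1)%:E].
  by apply: small_borel_partition; rewrite // invr_gt0 ltr0n.
by have [S SP] := choice ex; exists S; split => k; have [] := SP k.
Qed.

Lemma measurable_multiplicity :
  measurable_fun [set: caratheodory_type nu]
    (multiplicity f A : caratheodory_type nu -> \bar R).
Proof.
have [S [bS tS US dS]] := ex_partitions.
apply: (@emeasurable_fun_cvg _ (caratheodory_type nu) R setT
  (fun k => hits (S k))) => [k|y _].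
  by have [] := hits_properties (bS k) (tS k) (US k).
apply: hits_cvg => // k.
by have [] := hits_properties (bS k) (tS k) (US k).
Qed.

(** The integral of the multiplicity is the limit of the sums
    [\sum_i nu (f @` (A `&` S i))] along ever finer partitions [S], which
    also compute the pull-back measure: they are at most [psi A] by
    additivity and at least an approximating outer measure. *)
Lemma pullback_integral : pullback E f nu A =
  \int[nu : set (caratheodory_type nu) -> \bar R]_y multiplicity f A y.
Proof.
have [S [bS tS US dS]] := ex_partitions.
have hP k := hits_properties (bS k) (tS k) (US k).
have hcvg y : (fun k => hits (S k) y) @ \oo --> multiplicity f A y.
  by apply: hits_cvg => // k; have [] := hP k.
apply/eqP; rewrite eq_le; apply/andP; split; last first.
  rewrite (_ : multiplicity f A = fun y => limn_einf (fun k => hits (S k) y)).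
    2: by apply/funext => y; rewrite (cvg_limn_einf_sup (hcvg y)).1.
  apply: le_trans (fatou _ _ _ _) _ => //.
    by move=> k; have [] := hP k.
  rewrite limn_einf_lim; apply: lime_le; first exact: is_cvg_einfs.
  apply: nearW => k; apply: ereal_inf_le.
  exists (\int[nu : set (caratheodory_type nu) -> \bar R]_y hits (S k) y).
    by exists k => /=.
  by have [] := hP k.
have [B [bB BA AB0]] := borel_kernel mu_regular mu_bounded mA.
rewrite -/psi -[in leLHS](setDUK BA) (le_trans (outer_measureU2 _ _ _))//.
rewrite [X in _ + X](_ : _ = 0) ?adde0; last exact: pullback_ac.
apply: ge_ereal_sup => _ [r /= r0 <-]; have [k kr] := exists_invS_lt r0.
rewrite (setIidl (subset_trans BA AE)).
have [_ _ _ hkB] := hP k; apply: le_trans (hkB r B _ bB BA) _.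
  by move=> i; rewrite (le_trans (dS k i))// lee_fin ltW.
apply: ge0_le_integral => //.
- by have [] := hP k.
- exact: measurable_multiplicity.
- by move=> y _; have [] := hP k.
Qed.

End area.
(** * Differentiation along a Vitali relation *)

Section vlimsup.
Context {R : realType} {X : metricType R}.
Variables (V : set (X * set X)) (dmn : set (set X)) (phi : set X -> \bar R).

Let g x (eps : R) : \bar R := ereal_sup [set phi S | S in
  [set S | [/\ V (x, S), dmn S & diam S < eps%:E]]].

Let g_homo x e e' : (e <= e')%R -> g x e <= g x e'.
Proof.
move=> ee'; apply: le_ereal_sup => _ [S [VS dS Se] <-]; exists S => //.
by split => //; rewrite (lt_le_trans Se)// lee_fin.
Qed.

(** The suprema decrease with [eps], so their limit is an infimum; any right
    neighbourhood of 0 would do. *)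
Lemma vlimsupE x :
  vlimsup V dmn phi x = ereal_inf
    [set g x e | e in [set` Interval (BRight (0%R : R)) (BLeft (1%R : R))]].
Proof.
apply/cvg_lim => //.
apply: (@nondecreasing_at_right_cvge _ (g x) 0%R (BLeft 1%R)).
  by rewrite bnd_simp ltr01.
by move=> e e' _ _; exact: g_homo.
Qed.

Lemma vlimsup_gt x (c : \bar R) (e : R) :
  c < vlimsup V dmn phi x -> (0 < e)%R ->
  exists S, [/\ V (x, S), dmn S, diam S < e%:E & c < phi S].
Proof.
rewrite vlimsupE => cx e0; pose e' := Num.min e (1 / 2)%R.
have e'0 : (0 < e')%R by rewrite lt_min e0 divr_gt0.
have : c < g x e'.
  apply: (lt_le_trans cx); apply: ereal_inf_lbound; exists e' => //=.
  by rewrite in_itv/= e'0/= gt_min ltr_pdivrMr// mul1r ltr1n orbT.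
move=> /ereal_sup_gt[_ [S [VS dS Se] <-] cS]; exists S; split => //.
by rewrite (lt_le_trans Se)// lee_fin ge_min lexx.
Qed.

Lemma vlimsup_lt x (a : \bar R) : vlimsup V dmn phi x < a ->
  exists2 e : R, (0 < e)%R &
    forall S, V (x, S) -> dmn S -> diam S < e%:E -> phi S < a.
Proof.
rewrite vlimsupE => /ereal_inf_lt[_ [e eI <-] ge].
move: eI; rewrite /= in_itv/= => /andP[e0 _]; exists e => // S VS dS Se.
by apply: le_lt_trans ge; apply: ereal_sup_ubound; exists S.
Qed.

End vlimsup.

(** Clearing the denominator of a quotient that exceeds [c]; the cases of a
    null or infinite denominator follow the conventions [0^-1 = +oo] and
    [+oo^-1 = 0]. *)
Lemma gt_quotient {R : realType} (x y : \bar R) (c : R) : (0 <= c)%R ->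
  0 <= x -> 0 <= y -> c%:E < x / y -> c%:E * y <= x.
Proof.
move=> c0 x0; case: y => [y| |]//; rewrite ?lee_fin => y0.
- have [->|yn0] := eqVneq y 0%R; first by rewrite mule0.
  have {yn0}y0 : (0 < y)%R by rewrite lt_neqAle eq_sym yn0.
  by rewrite inver gt_eqF// lte_pdivlMr// => /ltW.
- by rewrite invey mule0 lte_fin ltNge c0.
Qed.

Lemma lt_quotient {R : realType} (x y : \bar R) (a : R) : (0 < a)%R ->
  0 <= x -> 0 <= y -> ~ (x = 0 /\ y = 0) -> x / y < a%:E -> x <= a%:E * y.
Proof.
move=> a0 x0; case: y => [y| |]//; rewrite ?lee_fin => y0.
- have [-> xy|yn0 _] := eqVneq y 0%R.
    have {xy}x0 : 0 < x.
      by rewrite lt_neqAle x0 andbT; apply/negP => /eqP x_eq0; apply: xy.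
    by rewrite inve0 gt0_muley.
  have {yn0}y0 : (0 < y)%R by rewrite lt_neqAle eq_sym yn0.
  by rewrite inver gt_eqF// lte_pdivrMr// => /ltW.
- by rewrite gt0_muley ?lte_fin// leey.
Qed.

Section vitali.
Context {R : realType} {X : completeMetricType R}.
Variables (mu psi : {outer_measure set X -> \bar R}) (V : set (X * set X)).
Hypotheses (mu_regular : borel_regular mu)
  (mu_bounded : finite_on_bounded mu)
  (psi_borel : borel_measure psi)
  (psi_bounded : finite_on_bounded psi)
  (psi_ac : abs_continuous psi mu)
  (V_vitali : vitali_relation mu V).

Let mu_borel : borel_measure mu. Proof. by have [] := mu_regular. Qed.

(** The covering property, for the members of [V] that lie in an open set and
    satisfy [P]: these are still fine on [Z], as small members lie in [U]. *)
Lemma vitali_cover (Z U : set X) (P : set X -> Prop) : open U -> Z `<=` U ->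
  (forall x (e : R), Z x -> (0 < e)%R ->
    exists S, [/\ V (x, S), diam S < e%:E & P S]) ->
  exists G : set (set X), [/\ countable G, trivIset G id,
    forall S, G S -> [/\ borel X S, S `<=` U & P S] &
    mu (Z `\` \bigcup_(S in G) S) = 0].
Proof.
have [V_cov V_borel _ V_fine] := V_vitali.
move=> oU ZU ZP.
have [||G [GC cG tG G0]] := V_fine
  [set p | [/\ V p, Z p.1, p.2 `<=` U & P p.2]] Z; last first.
- exists G; split => // S /GC[x Zx [/= VS _ SU PS]]; split => //.
  by apply: V_borel; exists x.
- move=> x Zx; apply/eqP; rewrite eq_le; apply/andP; split; last first.
    by apply: le_ereal_inf_tmp => _ [S _ <-]; exact: diam_ge0.
  apply/lee_addgt0Pr => e e0; rewrite add0e.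
  have : nbhs x U by apply: open_nbhs_nbhs; split => //; exact: ZU.
  rewrite -nbhs_ballE => -[r /= r0 rU].
  have m0 : (0 < Num.min e r)%R by rewrite lt_min e0 r0.
  have [S [VS Sd PS]] := ZP x _ Zx m0.
  apply: ereal_inf_le; exists (diam S).
    exists S => //; split => //= y Sy; apply: rU; rewrite ballEmdist/=.
    rewrite -lte_fin (le_lt_trans (mdist_le_diam (V_cov _ VS) Sy))//.
    by rewrite (lt_le_trans Sd)// lee_fin ge_min lexx orbT.
  by rewrite ltW// (lt_le_trans Sd)// lee_fin ge_min lexx.
- by move=> p [].
Qed.

Let D := vlimsup_quotient V psi mu.

(** If the upper derivative exceeds [c] on [Z], then [Z] is covered, up to a
    null set, by disjoint sets [S] with [c * mu S <= psi S]. *)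
Lemma upper_derivative_gt (Z Z' : set X) x (r c : R) : (0 <= c)%R ->
  Z `<=` Z' -> mu.-caratheodory Z' -> Z' `<=` ball x r ->
  (forall y, Z y -> c%:E < D y) -> c%:E * mu Z <= psi Z'.
Proof.
move=> c0 ZZ' mZ' Z'r cD.
have [_ /(_ Z')[H0 [bH0 Z'H0 muH0]]] := mu_regular.
pose H := H0 `&` ball x r.
have bH : borel X H.
  by apply: borelI => //; apply: borel_open; exact: ball_mdist_open.
have Z'H : Z' `<=` H by move=> y Z'y; split; [exact: Z'H0|exact: Z'r].
have Z'oo : mu Z' < +oo.
  by rewrite (le_lt_trans (le_outer_measure _ _ _ Z'r))// mu_ball_lty.
have HZ'0 : psi (H `\` Z') = 0.
  apply: psi_ac; apply: outer_measure_setD0 => //.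
  by rewrite -muH0; apply: le_outer_measure; exact: subIsetl.
have psiH : psi H <= psi Z'.
  rewrite -(setDUK Z'H) (le_trans (outer_measureU2 _ _ _))//.
  by rewrite HZ'0 adde0.
apply/lee_addgt0Pr => e e0.
have [U [oU HU Ue]] :=
  outer_regular psi_borel psi_bounded bH (@subIsetr _ _ _) e0.
have ZU : Z `<=` U by move=> y /ZZ' /Z'H /HU.
have [|G [cG tG GP G0]] := @vitali_cover Z U
    (fun S => c%:E * mu S <= psi S) oU ZU.
  move=> y s /cD /vlimsup_gt Dy s0; have [S [VS dS Ss cS]] := Dy _ s0.
  by exists S; split => //; apply: gt_quotient => //; exact: outer_measure_ge0.
apply: (@le_trans _ _ (psi U)); last first.
  by rewrite (le_trans Ue)// leeD2r.
apply: (@le_trans _ _ (c%:E * mu (\bigcup_(S in G) S))).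
  by rewrite lee_wpmul2l ?lee_fin// le_outer_measure_setD0.
have mG S : G S -> borel X S by move=> /GP[].
rewrite -(@caratheodory_bigcup_esum _ _ mu)//; last first.
  by move=> S /mG; exact: mu_borel.
have UG : \bigcup_(S in G) S `<=` U by move=> y [S /GP[_ + _]]; exact.
rewrite (le_trans _ (le_outer_measure _ _ _ UG))//.
rewrite -(@caratheodory_bigcup_esum _ _ psi)//; last first.
  by move=> S /mG; exact: psi_borel.
rewrite -countable_esumZl//.
by apply: le_esum => S /GP[].
Qed.

(** If the upper derivative is less than [a] on [Z], then a measurable hull of
    [Z] is covered, up to a null set, by disjoint sets [S] with
    [psi S <= a * mu S]. *)
Lemma upper_derivative_lt (Z Z' : set X) x (r a : R) : (0 < a)%R ->
  Z `<=` Z' -> mu.-caratheodory Z' -> Z' `<=` ball x r -> mu Z' = mu Z ->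
  (forall y, Z y -> D y < a%:E) -> psi Z' <= a%:E * mu Z'.
Proof.
move=> a0 ZZ' mZ' Z'r muZ' Da; have [_ _ V_fine0 _] := V_vitali.
have [_ /(_ Z)[H0 [bH0 ZH0 muH0]]] := mu_regular.
pose H := H0 `&` ball x r.
have bH : borel X H.
  by apply: borelI => //; apply: borel_open; exact: ball_mdist_open.
have ZH : Z `<=` H by move=> y Zy; split; [exact: ZH0|exact/Z'r/ZZ'].
have muH : mu H <= mu Z'.
  by rewrite muZ' -muH0; apply: le_outer_measure; exact: subIsetl.
have Z'oo : mu Z' < +oo.
  by rewrite (le_lt_trans (le_outer_measure _ _ _ Z'r))// mu_ball_lty.
apply/lee_addgt0Pr => e e0.
have ea0 : (0 < e / a)%R by rewrite divr_gt0.
have [U [oU HU Ue]] :=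
  outer_regular mu_borel mu_bounded bH (@subIsetr _ _ _) ea0.
have ZU : Z `<=` U by move=> y /ZH /HU.
have [|G [cG tG GP G0]] := @vitali_cover Z U
    (fun S => psi S <= a%:E * mu S) oU ZU.
  move=> y s /Da /vlimsup_lt[t t0 Dy] s0.
  have m0 : 0 < (Num.min s t)%:E by rewrite lte_fin lt_min s0.
  have /ereal_inf_lt[_ [S VS <-] Sm] :
      ereal_inf [set diam S | S in [set S | V (y, S)]] < (Num.min s t)%:E.
    by rewrite (V_fine0 y).
  exists S; split => //.
    by rewrite (lt_le_trans Sm)// lee_fin ge_min lexx.
  have [[-> ->]|dS] := pselect (psi S = 0 /\ mu S = 0); first by rewrite mule0.
  apply: lt_quotient => //; [exact: outer_measure_ge0..|].
  by apply: Dy => //; rewrite (lt_le_trans Sm)// lee_fin ge_min lexx orbT.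
have mG S : G S -> borel X S by move=> /GP[].
set W := \bigcup_(S in G) S.
have mW : mu.-caratheodory W.
  have [J [GJ tJ J1]] := countable_singletons cG.
  rewrite /W GJ bigcup_bigcup; apply: caratheodory_measurable_bigcup => n.
  have [Jn|[S Jn]] := J1 n; rewrite Jn ?bigcup_set0 ?bigcup_set1.
    exact: caratheodory_measurable_set0.
  by apply: mu_borel; apply: mG; rewrite GJ; exists n => //; rewrite Jn.
have Z'W0 : mu (Z' `\` W) = 0.
  rewrite (_ : Z' `\` W = Z' `\` (Z' `&` W)).
    2: by rewrite setDIr setDv set0U.
  apply: outer_measure_setD0.
  - exact: caratheodory_measurable_setI.
  - exact: subIsetl.
  - by rewrite (le_lt_trans _ Z'oo)//; apply: le_outer_measure; exact: subIsetl.
  rewrite muZ'; apply: le_outer_measure_setD0.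
  apply: outer_measure_subnull G0 => y [Zy nWy]; split => // Wy.
  by apply: nWy; split => //; exact: ZZ'.
apply: (@le_trans _ _ (psi W)).
  by apply: le_outer_measure_setD0; exact: psi_ac.
have WU : W `<=` U by move=> y [S /GP[_ + _]]; exact.
apply: (@le_trans _ _ (a%:E * mu U)); last first.
  rewrite (@le_trans _ _ (a%:E * (mu Z' + (e / a)%:E)))//.
    apply: lee_wpmul2l; first by rewrite lee_fin ltW.
    by rewrite (le_trans Ue)// leeD2r.
  rewrite muleDr ?fin_num_adde_defl//.
  by rewrite -EFinM mulrC divfK ?gt_eqF.
apply: (@le_trans _ _ (a%:E * mu W)); last first.
  by apply: lee_wpmul2l; [rewrite lee_fin ltW|exact: le_outer_measure].
rewrite -(@caratheodory_bigcup_esum _ _ mu)//; last first.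
  by move=> S /mG; exact: mu_borel.
rewrite -(@caratheodory_bigcup_esum _ _ psi)//; last first.
  by move=> S /mG; exact: psi_borel.
rewrite -countable_esumZl//; last exact: ltW.
by apply: le_esum => S /GP[].
Qed.

(** The upper derivative is negative exactly where all small sets of [V] are
    null. *)
Lemma upper_derivative_ge0 : mu [set x | D x < 0] = 0.
Proof.
have [_ _ V_fine0 _] := V_vitali; set Z := [set x | _].
have [|G [cG tG GP G0]] := @vitali_cover Z setT (fun S => mu S = 0) openT
    (@subsetT _ _).
  move=> y s /vlimsup_lt[t t0 Dy] s0.
  have m0 : 0 < (Num.min s t)%:E by rewrite lte_fin lt_min s0.
  have /ereal_inf_lt[_ [S VS <-] Sm] :
      ereal_inf [set diam S | S in [set S | V (y, S)]] < (Num.min s t)%:E.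
    by rewrite (V_fine0 y).
  exists S; split => //.
    by rewrite (lt_le_trans Sm)// lee_fin ge_min lexx.
  apply: contrapT => muS; have : psi S / mu S < 0.
    apply: Dy => //; first by case.
    by rewrite (lt_le_trans Sm)// lee_fin ge_min lexx orbT.
  by apply/negP; rewrite -leNgt mule_ge0// ?inve_ge0 ?outer_measure_ge0.
apply: outer_measure_le0.
apply: (le_trans (le_outer_measure_setD0 G0)).
rewrite (le_trans (outer_measure_bigcup_le_esum mu id cG))//.
by rewrite esum1// => S /GP[].
Qed.

End vitali.
(** The Radon-Nikodym theorem for measures whose finiteness properties are
    given as hypotheses. *)
Lemma finite_radon_nikodym d (T : measurableType d) (R : realType)
    (m p : {measure set T -> \bar R}) :
  sigma_finite setT m -> p setT < +oo ->
  (forall A, measurable A -> m A = 0 -> p A = 0) ->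
  exists h : T -> \bar R, [/\ forall x, 0 <= h x, forall x, h x \is a fin_num,
    measurable_fun setT h &
    forall A, measurable A -> p A = \int[m]_(x in A) h x].
Proof.
move=> sm poo ac.
have pfin : fin_num_fun p.
  move=> A mA; rewrite ge0_fin_numE// (le_lt_trans _ poo)//.
  by apply: le_measure; rewrite ?inE.
have sp : sigma_finite setT p.
  by apply: fin_num_fun_sigma_finite => //; rewrite measure0.
pose m' := HB.pack_for (SigmaFiniteMeasure.type T R) (Measure.sort m)
  (isSigmaFinite.Build _ _ _ _ sm)
  (isSFinite.Build _ _ _ _ (sfinite_measure_sigma_finite sm)).
pose p' := HB.pack_for (FiniteMeasure.type T R) (Measure.sort p)
  (isFinite.Build _ _ _ _ pfin)
  (isSFinite.Build _ _ _ _ (sfinite_measure_sigma_finite sp))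
  (isSigmaFinite.Build _ _ _ _ sp).
have [|h [h0 hfin /measurable_int hm ph]] :=
    @radon_nikodym_sigma_finite _ T R m' p'.
  by move=> N mN A mA AN; apply: ac => //; exact: mN.
by exists h; split.
Qed.

Section differentiation.
Context {R : realType} {X : completeMetricType R}.
Variables (mu psi : {outer_measure set X -> \bar R}) (V : set (X * set X)).
Hypotheses (mu_regular : borel_regular mu)
  (mu_bounded : finite_on_bounded mu)
  (psi_borel : borel_measure psi)
  (psi_bounded : finite_on_bounded psi)
  (psi_ac : abs_continuous psi mu)
  (V_vitali : vitali_relation mu V).

Let T := caratheodory_type mu.
Let mu_borel : borel_measure mu. Proof. by have [] := mu_regular. Qed.
Let D := vlimsup_quotient V psi mu.

Let mpsi : mu.-caratheodory `<=` psi.-caratheodory.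
Proof. exact: (caratheodory_ac mu_regular mu_bounded). Qed.

Let psi_sigma_additive : semi_sigma_additive (psi : set T -> \bar R).
Proof.
move=> A mA tA mUA.
apply: (@caratheodory_measure_sigma_additive _ _ psi A) => //.
  by move=> i; exact/mpsi/mA.
exact/mpsi/mUA.
Qed.

Let p : {measure set T -> \bar R} := HB.pack_for (Measure.type T R)
  (psi : set T -> \bar R)
  (isMeasure.Build _ T R (psi : set T -> \bar R) (outer_measure0 psi)
    (outer_measure_ge0 psi) psi_sigma_additive).

Let sigma_finite_mu : sigma_finite [set: T] (mu : set T -> \bar R).
Proof.
exists (fun n => ball point (n%:R : R)); first by rewrite bigcup_balls.
move=> n; split; last exact: mu_ball_lty.
by apply: mu_borel; apply: borel_open; exact: ball_mdist_open.
Qed.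

(** The upper derivative agrees with the density [h] almost everywhere.  Where
    they differ, two rationals [a < c] separate them.  If [h < a] and [c < D]
    on [Z], then on a hull [Z'] of [Z] inside [O] and [h < a] we have
    [c * mu Z <= psi Z' <= a * mu Z]; if [D < a] and [c < h] on [Z], then on a
    hull [Z'] inside [O] and [c < h] we have
    [c * mu Z' <= psi Z' <= a * mu Z'].  In both cases [Z] is null. *)
Let derivative_density O x (r : R) (h : T -> \bar R) : mu.-caratheodory O ->
  O `<=` ball x r -> measurable_fun setT h -> (forall y, 0 <= h y) ->
  (forall y, h y \is a fin_num) ->
  (forall A, mu.-caratheodory A -> A `<=` O ->
    psi A = \int[mu : set T -> \bar R]_(y in A) h y) ->
  mu [set y | O y /\ D y <> h y] = 0.
Proof.
move=> mO Or mh h0 hfin psih; have [_ hullP] := mu_regular.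
have muO A : A `<=` O -> mu A \is a fin_num.
  move=> AO; rewrite ge0_fin_numE ?outer_measure_ge0//.
  rewrite (le_lt_trans (le_outer_measure _ _ _ AO))//.
  by rewrite (le_lt_trans (le_outer_measure _ _ _ Or))// mu_ball_lty.
have null (a c : R) (A : set X) : (a < c)%R -> A `<=` O ->
    c%:E * mu A <= a%:E * mu A -> mu A = 0.
  move=> ac /muO Afin; have := outer_measure_ge0 mu A.
  rewrite -(fineK Afin) -!EFinM !lee_fin => A0 cA; congr EFin.
  by apply/eqP; rewrite eq_le A0 andbT; nra.
have hull Z W : Z `<=` W -> W `<=` O -> mu.-caratheodory W ->
    exists Z', [/\ mu.-caratheodory Z', Z `<=` Z', Z' `<=` W & mu Z' = mu Z].
  move=> ZW WO mW; have [H [bH ZH muH]] := hullP Z.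
  exists (H `&` W); split.
  - by apply: caratheodory_measurable_setI => //; exact: mu_borel.
  - by move=> y Zy; split; [exact: ZH|exact: ZW].
  - exact: subIsetr.
  apply/eqP; rewrite eq_le -{1}muH; apply/andP; split; apply: le_outer_measure.
    exact: subIsetl.
  by move=> y Zy; split; [exact: ZH|exact: ZW].
pose Zp (q : rat * rat) := [set y | [/\ O y, h y < (ratr q.1)%:E,
  (ratr q.2)%:E < D y & (0 < (ratr q.1 : R) < ratr q.2)%R]].
pose Zm (q : rat * rat) := [set y | [/\ O y, D y < (ratr q.1)%:E,
  (ratr q.2)%:E < h y & (0 < (ratr q.1 : R) < ratr q.2)%R]].
have Zp0 q : mu (Zp q) = 0.
  have [/andP[a0 ac]|nac] := pselect (0 < (ratr q.1 : R) < ratr q.2)%R.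
    2: by rewrite (_ : Zp q = set0)// -subset0 => y [].
  set a := ratr q.1 in a0 ac; set c := ratr q.2 in ac.
  pose W := O `&` [set y | h y < a%:E].
  have mW : mu.-caratheodory W.
    apply: caratheodory_measurable_setI => //.
    have := @emeasurable_fun_infty_o _ T R setT h measurableT mh a%:E.
    by rewrite setTI.
  have ZW : Zp q `<=` W by move=> y [Oy hy].
  have WO : W `<=` O by exact: subIsetl.
  have [Z' [mZ' ZZ' Z'W muZ']] := hull _ _ ZW WO mW.
  apply: (null a c) => //; first exact: subset_trans ZW WO.
  apply: (@le_trans _ _ (psi Z')).
    apply: (upper_derivative_gt mu_regular mu_bounded psi_borel psi_bounded
      psi_ac V_vitali (x := x) (r := r)) => //.
    - by rewrite ltW// (lt_trans a0).
    - by move=> y /Z'W/WO/Or.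
    - by move=> y [].
  rewrite psih//; last exact: subset_trans Z'W WO.
  rewrite -muZ'.
  have := @integral_cst _ T R (mu : set T -> \bar R) Z' mZ' a%:E.
  move=> <-; apply: ge0_le_integral => //.
  - exact: measurable_funTS.
  - by move=> y /Z'W[_ /ltW].
have Zm0 q : mu (Zm q) = 0.
  have [/andP[a0 ac]|nac] := pselect (0 < (ratr q.1 : R) < ratr q.2)%R.
    2: by rewrite (_ : Zm q = set0)// -subset0 => y [].
  set a := ratr q.1 in a0 ac; set c := ratr q.2 in ac.
  pose W := O `&` [set y | c%:E < h y].
  have mW : mu.-caratheodory W.
    apply: caratheodory_measurable_setI => //.
    have := @emeasurable_fun_o_infty _ T R setT h measurableT mh c%:E.
    by rewrite setTI.
  have ZW : Zm q `<=` W by move=> y [Oy _ hy].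
  have WO : W `<=` O by exact: subIsetl.
  have [Z' [mZ' ZZ' Z'W muZ']] := hull _ _ ZW WO mW.
  rewrite -muZ'; apply: (null a c) => //; first exact: subset_trans Z'W WO.
  apply: (@le_trans _ _ (psi Z')); last first.
    apply: (upper_derivative_lt mu_regular mu_bounded psi_borel
      psi_ac V_vitali (x := x) (r := r) a0 ZZ') => //.
    - by move=> y /Z'W/WO/Or.
    - by move=> y [].
  rewrite psih//; last exact: subset_trans Z'W WO.
  have := @integral_cst _ T R (mu : set T -> \bar R) Z' mZ' c%:E.
  move=> <-; apply: ge0_le_integral => //.
  - by move=> y _; rewrite /= lee_fin ltW// (lt_trans a0).
  - exact: measurable_funTS.
  - by move=> y /Z'W[_ /ltW].
have bigcup_rat0 (F : rat * rat -> set X) : (forall q, mu (F q) = 0) ->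
    mu (\bigcup_q F q) = 0.
  move=> F0; apply: outer_measure_le0.
  rewrite (le_trans (outer_measure_bigcup_le_esum mu F _))//.
    exact: countableP.
  by rewrite esum1.
apply: (@outer_measure_subnull _ _ _ _
    ([set y | D y < 0] `|` (\bigcup_q Zp q `|` \bigcup_q Zm q))); last first.
  apply: outer_measureU0.
    exact: upper_derivative_ge0.
  by apply: outer_measureU0; exact: bigcup_rat0.
move=> y [Oy /eqP Dh].
have between (s t : \bar R) : 0 <= s -> s \is a fin_num -> s < t ->
    exists q : rat * rat, [/\ s < (ratr q.1)%:E, (ratr q.2)%:E < t &
      (0 < (ratr q.1 : R) < ratr q.2)%R].
  case: s => [s| |]// s0 _ st.
  have [u [su ut]] : exists u : R, (s < u)%R /\ u%:E <= t.
    case: t st => [t| |]// st; first by exists t.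
    by exists (s + 1)%R; rewrite ltrDl leey.
  have [c] := rat_in_itvoo su; rewrite in_itv/= => /andP[sc cu].
  have [a] := rat_in_itvoo sc; rewrite in_itv/= => /andP[sa ac].
  exists (a, c); split => /=.
  - by rewrite lte_fin.
  - by rewrite (lt_le_trans _ ut)// lte_fin.
  - by rewrite ac andbT (le_lt_trans _ sa).
have [|D0] := ltP (D y) 0; first by left.
right; move: Dh; rewrite neq_lt => /orP[Dh|hD].
  right; have Dfin : D y \is a fin_num.
    by rewrite ge0_fin_numE// (lt_trans Dh)// -ge0_fin_numE.
  by have [q [? ? ?]] := between _ _ D0 Dfin Dh; exists q.
by left; have [q [? ? ?]] := between _ _ (h0 y) (hfin y) hD; exists q.
Qed.

(** Differentiation theorem: the upper derivative of [psi] along a Vitali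
    relation is almost everywhere equal to a density of [psi]. *)
Lemma vitali_density : exists h : T -> \bar R,
  [/\ measurable_fun setT h, forall x, 0 <= h x, forall x, h x \is a fin_num,
      mu [set x | D x <> h x] = 0 &
      forall A, mu.-caratheodory A ->
        psi A = \int[mu : set T -> \bar R]_(x in A) h x].
Proof.
(* The annuli O n are bounded, so that psi is finite on each of them. *)
pose O := seqDU (fun n => ball (point : X) (n%:R : R)).
have bO n : borel X (O n).
  by apply: borel_seqDU => k; apply: borel_open; exact: ball_mdist_open.
have mO n : mu.-caratheodory (O n) by exact: mu_borel.
have Or n : O n `<=` ball point (n%:R : R) by exact: subset_seqDU.
have UO : \bigcup_n O n = setT by rewrite -seqDU_bigcup_eq bigcup_balls.
have tO : trivIset setT O by exact: trivIset_seqDU.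
have ex n : exists h : T -> \bar R,
    [/\ forall x, 0 <= h x, forall x, h x \is a fin_num,
        measurable_fun setT h &
        forall A, mu.-caratheodory A ->
          psi (A `&` O n) = \int[mu : set T -> \bar R]_(x in A) h x].
  have mOT : measurable (O n : set T) by exact: mO.
  have [||h [h0 hfin mh ph]] := @finite_radon_nikodym _ T R
      (mu : set T -> \bar R) (mrestr p mOT) sigma_finite_mu.
  - apply: (@le_lt_trans _ _ (psi (ball point (n%:R : R)))).
      by apply: (le_outer_measure psi) => x [_ /Or].
    exact: mu_ball_lty.
  - move=> A mA A0; rewrite /mrestr/=; apply: psi_ac.
    by apply: outer_measure_subnull A0; exact: subIsetl.
  by exists h; split.
have [hn hnP] := choice ex.
have exn x : exists n, O n x.
  by have : setT x by []; rewrite -UO => -[n]; exists n.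
(* The densities on the annuli are glued together. *)
have [k kP] := choice exn.
pose h x := hn (k x) x.
have hE n x : O n x -> h x = hn n x.
  move=> Onx; rewrite /h; congr (hn _ x).
  by apply: tO => //; exists x; split.
have h0 x : 0 <= h x by have [h0 _ _ _] := hnP (k x); exact: h0.
have hfin x : h x \is a fin_num.
  by have [_ hfin _ _] := hnP (k x); exact: hfin.
have mh : measurable_fun (setT : set T) h.
  rewrite -UO; apply/(@measurable_fun_bigcup _ _ T _ O h mO) => n.
  apply: (eq_measurable_fun (hn n)); last first.
    by apply: measurable_funTS; have [] := hnP n.
  by move=> x; rewrite inE => /hE.
have psih n A : mu.-caratheodory A -> A `<=` O n ->
    psi A = \int[mu : set T -> \bar R]_(x in A) h x.
  move=> mA AO; have [_ _ _ ph] := hnP n.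
  rewrite -(setIidl AO) ph// setIidl//.
  by apply: eq_integral => x; rewrite inE => /AO /hE.
exists h; split => //.
- apply: (@outer_measure_subnull _ _ _ _
      (\bigcup_n [set x | O n x /\ D x <> h x])).
    by move=> x Dx; exists (k x).
  apply: outer_measure_bigcup0 => n.
  by apply: (derivative_density (mO n) (Or n)) => // A; exact: psih.
- move=> A mA; rewrite -[in LHS](setIT A) -[in RHS](setIT A) -UO setI_bigcupr.
  have mAO n : mu.-caratheodory (A `&` O n).
    exact: caratheodory_measurable_setI.
  have tAO : trivIset setT (fun n => A `&` O n) by exact: trivIset_setIl.
  have := @ge0_integral_bigcup _ T R (mu : set T -> \bar R)
    (fun n => A `&` O n) h mAO.
  move=> /= -> //; last exact: measurable_funTS.
  have := @measure_semi_bigcup _ _ _ p (fun n => A `&` O n) mAO tAO.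
  move=> /= ->; last exact: caratheodory_measurable_bigcup.
  by apply: eq_eseriesr => n _; apply: (psih n) => //; exact: subIsetr.
Qed.

End differentiation.

Theorem theorem1 (R : realType) (X : completeMetricType R) (Y : pmetricType R)
    (mu : {outer_measure set X -> \bar R})
    (nu : {outer_measure set Y -> \bar R})
    (V : set (X * set X)) (E : set X) (f : X -> Y)
    (sepX : separable_space X)
    (mu_regular : borel_regular mu)
    (mu_bounded : finite_on_bounded mu)
    (nu_borel : borel_measure nu)
    (V_vitali : vitali_relation mu V)
    (E_closed : closed E)
    (f_continuous : {within E, continuous f})
    (pullback_bounded : finite_on_bounded (pullback E f nu))
    (pullback_ac : abs_continuous (pullback E f nu) mu) :
  [/\ mu [set x | E x /\ ~~ (metric_jacobian V E f mu nu x \is a fin_num)] = 0,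
      measurable_fun (E : set (caratheodory_type mu))
        (metric_jacobian V E f mu nu) &
      forall A : set X, mu.-caratheodory A -> A `<=` E ->
        measurable_fun [set: caratheodory_type nu]
          (multiplicity f A : caratheodory_type nu -> \bar R) /\
        \int[mu : set (caratheodory_type mu) -> \bar R]_(x in A)
            metric_jacobian V E f mu nu x =
        \int[nu : set (caratheodory_type nu) -> \bar R]_y
            multiplicity f A y].
Proof.
have [h [mh h0 hfin Dh0 psih]] := vitali_density mu_regular mu_bounded
  (@pullback_borel _ _ _ E f nu) pullback_bounded pullback_ac V_vitali.
have mE : mu.-caratheodory E.
  by have [mu_borel _] := mu_regular; apply: mu_borel; exact: borel_closed.
have ae (B : set (caratheodory_type mu)) :
    ae_eq (mu : set (caratheodory_type mu) -> \bar R) B h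
      (metric_jacobian V E f mu nu).
  exists [set x | metric_jacobian V E f mu nu x <> h x]; split => //.
    exact: null_caratheodory.
  by move=> x /= /not_implyP[_ /nesym].
have mD (B : set (caratheodory_type mu)) :
    measurable_fun B (metric_jacobian V E f mu nu).
  apply: (ae_measurable_fun (@measure_is_complete_caratheodory _ _ mu) (ae B)).
  exact: measurable_funTS.
split => //.
  apply: outer_measure_subnull Dh0 => x [_ /negP Dx] Dh.
  by apply: Dx; rewrite /metric_jacobian Dh.
move=> A mA AE; split.
  exact: (measurable_multiplicity (mu := mu) (E := E)).
rewrite -(pullback_integral sepX mu_regular mu_bounded nu_borel
  f_continuous pullback_bounded pullback_ac mA AE).
rewrite psih//; apply/esym; apply: ae_eq_integral => //.
exact: measurable_funTS.
Qed.
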